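(* For all terms $M,N$ of the $\partial_0\lambda$-calculus with tests and every repetition-free list of variables $\vec x$ containing the free variables of $M$ and $N$: $$\llbracket M\rrbracket_{\vec x}\subseteq\llbracket N\rrbracket_{\vec x}\iff M\sqsubseteq^{\tau}_{\mathcal O} N.$$ (That is, the relational model $\mathcal D$ is inequationally fully abstract for the $\partial_0\lambda$-calculus with tests.)
   Context: Syntax of the $\partial_0\lambda$-calculus with tests. Terms $M,N,L$, bags $P$ and tests $V,W$ are given by $M ::= x \mid \lambda x.M \mid MP \mid \bar\tau(V)$, $P ::= [L_1,\dots,L_k]$, $V ::= \tau[L_1,\dots,L_k]$ ($k\ge 0$), where bags and tests are finite multisets of terms (the tag $\tau$ distinguishes tests from bags); expressions (terms, bags, tests) are taken up to $\alpha$-equivalence. $\uplus$ denotes union of bags; for tests, $\varepsilon:=\tau[\,]$ and $V\mid W$ is multiset union. For each sort, sums are finite formal sums with idempotent addition (equivalently finite sets), $0$ being the empty sum. All constructors are extended to sums by multilinearity (e.g. $\lambda x.\sum_i M_i=\sum_i\lambda x.M_i$, $(\sum_i M_i)(\sum_j P_j)=\sum_{i,j}M_iP_j$, $[\sum_i L_i]\uplus P=\sum_i[L_i]\uplus P$, $\tau[\sum_iM_i]\mid V=\sum_i\tau[M_i]\mid V$); in particular any constructor applied to $0$ gives $0$. $A\{N/x\}$ is capture-avoiding substitution, extended to sums by these conventions (so $A\{0/x\}=0$ if $x$ is free in $A$, and $A\{0/x\}=A$ otherwise). Linear substitution: $x\langle N/x\rangle=N$; $y\langle N/x\rangle=0$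 for $y\neq x$; $(\lambda y.M)\langle N/x\rangle=\lambda y.M\langle N/x\rangle$; $(MP)\langle N/x\rangle=M\langle N/x\rangle P+M(P\langle N/x\rangle)$; $\bar\tau(V)\langle N/x\rangle=\bar\tau(V\langle N/x\rangle)$; $[L_1,\dots,L_k]\langle N/x\rangle=\sum_{i=1}^k[L_1,\dots,L_i\langle N/x\rangle,\dots,L_k]$ and likewise for tests; extended linearly to sums. For a bag $P=[L_1,\dots,L_k]$ with $x$ not free in $P$, $A\langle P/x\rangle:=A\langle L_1/x\rangle\cdots\langle L_k/x\rangle$ (independent of the order). Reduction: base rules $(\lambda x.M)P\to M\langle P/x\rangle\{0/x\}$ ($x$ not free in $P$); $\bar\tau(V)P\to\bar\tau(V)$ if $P=[\,]$ and $\bar\tau(V)P\to 0$ otherwise; $\tau[\lambda x.M]\mid V\to\tau[M\{0/x\}]\mid V$; $\tau[\bar\tau(V)]\mid W\to V\mid W$. The relation $\to$ on sums is the closure of these rules under every syntactic position (body of a $\lambda$, either side of an application, an element of a bag, inside $\bar\tau$, an element of a test) and under sums ($A+\mathbb B\to\mathbb A+\mathbb B$ if $A\to\mathbb A$); $\twoheadrightarrow$ is its reflexive-transitive closure. Contexts and preorder. Term-contexts $D ::= [\cdot]\mid\lambda x.D\mid DP\mid M[D,L_1,\dots,L_k]\mid\bar\tau(C)$ and test-contexts $C::=\tau[D,L_1,\dots,L_k]$; $C[M]$ is obtained by replacing the hole by $M$, allowing capture. $M\sqsubseteq^{\tau}_{\mathcal O}N$ iff for every test-context $C$ such that $C[M]$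 and $C[N]$ are closed, $C[M]\twoheadrightarrow\varepsilon$ implies $C[N]\twoheadrightarrow\varepsilon$. The model $\mathcal D$. For a set $S$, $\mathcal M_f(S)$ is the set of finite multisets over $S$. Let $D_0=\emptyset$, $D_{n+1}$ the set of $\mathbb N$-indexed sequences $(a_1,a_2,\dots)$ of elements of $\mathcal M_f(D_n)$ with $a_i=[\,]$ for all but finitely many $i$, and $\mathcal D=\bigcup_n D_n$. For $a\in\mathcal M_f(\mathcal D)$ and $\alpha=(a_1,a_2,\dots)\in\mathcal D$, $a::\alpha:=(a,a_1,a_2,\dots)$; $*:=([\,],[\,],\dots)$. $\uplus$ on tuples of multisets is componentwise. For a repetition-free list $\vec x=x_1,\dots,x_n$ containing the free variables, define $\llbracket M\rrbracket_{\vec x}\subseteq\mathcal M_f(\mathcal D)^n\times\mathcal D$, $\llbracket P\rrbracket_{\vec x}\subseteq\mathcal M_f(\mathcal D)^n\times\mathcal M_f(\mathcal D)$, $\llbracket V\rrbracket_{\vec x}\subseteq\mathcal M_f(\mathcal D)^n$ by: $\llbracket x_i\rrbracket_{\vec x}=\{(([\,],\dots,[\alpha],\dots,[\,]),\alpha):\alpha\in\mathcal D\}$ ($[\alpha]$ in position $i$); $\llbracket\lambda y.M\rrbracket_{\vec x}=\{(\vec a,b::\alpha):((\vec a,b),\alpha)\in\llbracket M\rrbracket_{\vec x,y}\}$ ($y\notin\vec x$); $\llbracket MP\rrbracket_{\vec x}=\{(\vec a_1\uplus\vec a_2,\alpha):\exists b\,(\vec a_1,b::\alpha)\in\llbracket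 M\rrbracket_{\vec x},(\vec a_2,b)\in\llbracket P\rrbracket_{\vec x}\}$; $\llbracket\bar\tau(V)\rrbracket_{\vec x}=\{(\vec a,* ):\vec a\in\llbracket V\rrbracket_{\vec x}\}$; $\llbracket[L_1,\dots,L_k]\rrbracket_{\vec x}=\{(\biguplus_i\vec a_i,[\beta_1,\dots,\beta_k]):(\vec a_i,\beta_i)\in\llbracket L_i\rrbracket_{\vec x}\}$; $\llbracket\tau[L_1,\dots,L_k]\rrbracket_{\vec x}=\{\biguplus_i\vec a_i:(\vec a_i,* )\in\llbracket L_i\rrbracket_{\vec x}\}$; the interpretation of a sum is the union of the interpretations of its summands. *)

(* Defs.v *)
From HB Require Import structures.
From mathcomp Require Import all_boot all_order finmap multiset.

Set Implicit Arguments.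
Unset Strict Implicit.
Unset Printing Implicit Defensive.

(* Alpha-equivalence classes are represented by de Bruijn terms.  The named
   variables are x_0, x_1, x_2, ...; under d binders, [Var i] is the variable
   bound by the (i+1)-st enclosing binder if i < d, and the variable x_(i-d)
   otherwise.
   Bags and tests are finite multisets of terms: both are given by a list, the
   sort (hence the tag tau) being determined by the position or the type; the
   order of the elements is forgotten by [eqv] below. *)
Inductive term : Type :=
| Var of nat
| Lam of term
| App of term & seq term
| TBar of seq term.

Definition bag := seq term.
Definition test := seq term.
Definition eps : test := [::].

Lemma term_nested_ind (P : term -> Prop) :
  (forall x, P (Var x)) ->
  (forall M, P M -> P (Lam M)) ->
  (forall M Ls, P M -> foldr (fun L => and (P L)) True Ls -> P (App M Ls)) ->
  (forall Ls, foldr (fun L => and (P L)) True Ls -> P (TBar Ls)) ->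
  forall M, P M.
Proof.
move=> hV hL hA hT; fix IH 1; case=> [x|M|M Ls|Ls].
- exact: hV.
- exact/hL/IH.
- by apply: hA; [exact: IH | elim: Ls => //= L Ls IHLs; split].
- by apply: hT; elim: Ls => //= L Ls IHLs; split.
Qed.

Fixpoint term_encode (M : term) : GenTree.tree nat :=
  match M with
  | Var x => GenTree.Leaf x
  | Lam M => GenTree.Node 0 [:: term_encode M]
  | App M Ls => GenTree.Node 1 (term_encode M :: map term_encode Ls)
  | TBar Ls => GenTree.Node 2 (map term_encode Ls)
  end.

Fixpoint term_decode (t : GenTree.tree nat) : term :=
  match t with
  | GenTree.Leaf x => Var x
  | GenTree.Node 0 [:: t] => Lam (term_decode t)
  | GenTree.Node 1 (t :: ts) => App (term_decode t) (map term_decode ts)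
  | GenTree.Node _ ts => TBar (map term_decode ts)
  end.

Lemma term_encodeK : cancel term_encode term_decode.
Proof.
have mapK (Ls : seq term) :
    foldr (fun L => and (term_decode (term_encode L) = L)) True Ls ->
    map term_decode (map term_encode Ls) = Ls.
  by elim: Ls => //= L Ls IH [-> /IH ->].
elim/term_nested_ind => //= [M ->|M Ls -> /mapK ->|Ls /mapK ->] //.
Qed.

HB.instance Definition _ := Countable.copy term (can_type term_encodeK).

Definition up (r : nat -> nat) (i : nat) : nat :=
  if i is j.+1 then (r j).+1 else 0.

Fixpoint ren (r : nat -> nat) (M : term) : term :=
  match M with
  | Var x => Var (r x)
  | Lam M => Lam (ren (up r) M)
  | App M P => App (ren r M) [seq ren r L | L <- P]
  | TBar V => TBar [seq ren r L | L <- V]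
  end.

Definition shift : term -> term := ren succn.

Fixpoint free (x : nat) (M : term) : bool :=
  match M with
  | Var y => y == x
  | Lam M => free x.+1 M
  | App M P => free x M || has (free x) P
  | TBar V => has (free x) V
  end.

Definition closed_test (V : test) : Prop := forall x, ~~ has (free x) V.

(* The named abstraction "lambda x_i. M". *)
Definition lam (i : nat) (M : term) : term :=
  Lam (ren (fun j => if j == i then 0 else j.+1) M).

(* Equality of terms, resp. of bags and tests, as finite multisets. *)
Inductive eqv : term -> term -> Prop :=
| eqv_var x : eqv (Var x) (Var x)
| eqv_lam M M' : eqv M M' -> eqv (Lam M) (Lam M')
| eqv_app M M' P P' : eqv M M' -> eqvs P P' -> eqv (App M P) (App M' P')
| eqv_tbar V V' : eqvs V V' -> eqv (TBar V) (TBar V')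
with eqvs : seq term -> seq term -> Prop :=
| eqvs_nil : eqvs [::] [::]
| eqvs_cons L L' P P' : eqv L L' -> eqvs P P' -> eqvs (L :: P) (L' :: P')
| eqvs_swap L1 L2 P : eqvs (L1 :: L2 :: P) (L2 :: L1 :: P)
| eqvs_trans P Q R : eqvs P Q -> eqvs Q R -> eqvs P R.

(* A finite sum is the list of its summands; by [eqsum] neither order nor
   repetitions matter, so that addition (++) is idempotent. *)
Definition eqsum (T : eqType) (e : T -> T -> Prop) (S S' : seq T) : Prop :=
  (forall A, A \in S -> exists2 B, B \in S' & e A B) /\
  (forall B, B \in S' -> exists2 A, A \in S & e A B).

(* The sum of the [L_1, .., L_i', .., L_k] for L_i' a summand of f L_i. *)
Fixpoint sum_at_one (f : term -> seq term) (P : seq term) : seq (seq term) :=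
  if P is L :: Q then
    [seq L' :: Q | L' <- f L] ++ [seq L :: Q' | Q' <- sum_at_one f Q]
  else [::].

Fixpoint lsubst (x : nat) (N : term) (M : term) : seq term :=
  match M with
  | Var y => if y == x then [:: N] else [::]
  | Lam M => [seq Lam M' | M' <- lsubst x.+1 (shift N) M]
  | App M P => [seq App M' P | M' <- lsubst x N M]
            ++ [seq App M P' | P' <- sum_at_one (lsubst x N) P]
  | TBar V => [seq TBar V' | V' <- sum_at_one (lsubst x N) V]
  end.

Definition lsubst_bag (x : nat) (P : bag) (M : term) : seq term :=
  foldl (fun S L => flatten [seq lsubst x L A | A <- S]) [:: M] P.

(* M{0/x} for x the variable of index 0, which does not occur in the result:
   the latter is therefore read outside of the scope of x. *)
Definition zsubst (M : term) : seq term :=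
  if free 0 M then [::] else [:: ren predn M].

(* M<P/x>{0/x} for x the variable of index 0; P lives outside of its scope. *)
Definition beta (M : term) (P : bag) : seq term :=
  flatten [seq zsubst M' | M' <- lsubst_bag 0 (map shift P) M].

Inductive red_tm : term -> seq term -> Prop :=
| red_beta M P : red_tm (App (Lam M) P) (beta M P)
| red_tbar_nil V : red_tm (App (TBar V) [::]) [:: TBar V]
| red_tbar_cons V L P : red_tm (App (TBar V) (L :: P)) [::]
| red_lam M Ms : red_tm M Ms -> red_tm (Lam M) [seq Lam M' | M' <- Ms]
| red_appl M Ms P : red_tm M Ms -> red_tm (App M P) [seq App M' P | M' <- Ms]
| red_appr M P Ps : red_bag P Ps -> red_tm (App M P) [seq App M P' | P' <- Ps]
| red_tbar V Vs : red_test V Vs -> red_tm (TBar V) [seq TBar V' | V' <- Vs]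
with red_bag : bag -> seq bag -> Prop :=
| red_bag_elt P L Ls Q : red_tm L Ls ->
    red_bag (P ++ L :: Q) [seq P ++ L' :: Q | L' <- Ls]
with red_test : test -> seq test -> Prop :=
| red_tau_lam V M W :
    red_test (V ++ Lam M :: W) [seq V ++ M' :: W | M' <- zsubst M]
| red_tau_tbar V U W : red_test (V ++ TBar U :: W) [:: V ++ U ++ W]
| red_test_elt V L Ls W : red_tm L Ls ->
    red_test (V ++ L :: W) [seq V ++ L' :: W | L' <- Ls].

Section Sums.
Variables (T : eqType) (e : T -> T -> Prop) (red : T -> seq T -> Prop).

Definition red_sum (S S' : seq T) : Prop :=
  exists A As Bs, [/\ red A As, eqsum e S (A :: Bs) & eqsum e S' (As ++ Bs)].

Inductive reds : seq T -> seq T -> Prop :=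
| reds_refl S S' : eqsum e S S' -> reds S S'
| reds_step S1 S2 S3 : red_sum S1 S2 -> reds S2 S3 -> reds S1 S3.

End Sums.

Definition reds_test : seq test -> seq test -> Prop := reds eqvs red_test.

(* Contexts are not considered up to alpha-equivalence: their binders are
   named, and capture the variables of the term plugged into the hole. *)
Inductive tctx : Type :=
| Hole
| CLam of nat & tctx
| CAppL of tctx & bag
| CAppR of term & tctx & seq term
| CTBar of vctx
with vctx : Type :=
| CTau of tctx & seq term.

Fixpoint tplug (D : tctx) (M : term) : term :=
  match D with
  | Hole => M
  | CLam x D => lam x (tplug D M)
  | CAppL D P => App (tplug D M) P
  | CAppR N D Ls => App N (tplug D M :: Ls)
  | CTBar C => TBar (vplug C M)
  end
with vplug (C : vctx) (M : term) : test :=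
  match C with
  | CTau D Ls => tplug D M :: Ls
  end.

Definition obs_le (M N : term) : Prop :=
  forall C : vctx, closed_test (vplug C M) -> closed_test (vplug C N) ->
    reds_test [:: vplug C M] [:: eps] -> reds_test [:: vplug C N] [:: eps].

(* [dom] is the least solution of: dom = the N-indexed sequences, almost
   everywhere empty, of finite multisets over dom.  Its elements are the
   canonical forms of finitely nested lists: the inner lists, which stand for
   multisets, are sorted, and the outer ones, which stand for sequences, have
   no trailing empty multiset.  The lemmas [entry_dcons], [entry_star],
   [entry_finite], [dom_ext], [dom_seq] and [dom_nested_ind] show that [dom] is
   as announced. *)
Inductive rawdom : Type := RawDom of seq (seq rawdom).

Definition rawseq (r : rawdom) : seq (seq rawdom) := let: RawDom ss := r in ss.

Lemma rawdom_nested_ind (P : rawdom -> Prop) :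
  (forall ss, foldr (fun s => and (foldr (fun r => and (P r)) True s)) True ss
     -> P (RawDom ss)) ->
  forall r, P r.
Proof.
move=> hR; fix IH 1; case=> ss; apply: hR.
by elim: ss => //= s ss IHss; split=> //; elim: s => //= r s IHs; split.
Qed.

Fixpoint raw_encode (r : rawdom) : GenTree.tree unit :=
  let: RawDom ss := r in
  GenTree.Node 0 [seq GenTree.Node 0 [seq raw_encode x | x <- s] | s <- ss].

Fixpoint raw_decode (t : GenTree.tree unit) : rawdom :=
  match t with
  | GenTree.Leaf _ => RawDom [::]
  | GenTree.Node _ ts =>
      RawDom [seq if t is GenTree.Node _ us then [seq raw_decode u | u <- us]
                  else [::] | t <- ts]
  end.

Lemma raw_encodeK : cancel raw_encode raw_decode.
Proof.
elim/rawdom_nested_ind => ss /= h; congr RawDom.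
elim: ss h => //= s ss IH [hs /IH ->]; congr cons.
by elim: s hs {IH} => //= r s IH [-> /IH ->].
Qed.

HB.instance Definition _ := Countable.copy rawdom (can_type raw_encodeK).

Lemma rawdom_ind_in (P : rawdom -> Prop) :
  (forall ss : seq (seq rawdom),
     (forall s r, s \in ss -> r \in s -> P r) -> P (RawDom ss)) ->
  forall r, P r.
Proof.
move=> hR; elim/rawdom_nested_ind => ss h; apply: hR => s r.
elim: ss h => //= s' ss IH [hs /IH h]; rewrite inE => /orP[/eqP->|/h //].
elim: s' hs => //= r' s' IHs [Pr /IHs h'].
by rewrite inE => /orP[/eqP->|/h'].
Qed.

Definition raw_le : rel rawdom := relpre (@choice.pickle rawdom) leq.

Lemma raw_le_total : total raw_le.
Proof. by move=> x y; exact: leq_total. Qed.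
Lemma raw_le_trans : transitive raw_le.
Proof. by move=> x y z; exact: leq_trans. Qed.
Lemma raw_le_anti : antisymmetric raw_le.
Proof. by move=> x y /anti_leq /(pcan_inj choice.pickleK). Qed.

Fixpoint trim (T : Type) (ss : seq (seq T)) : seq (seq T) :=
  if ss is s :: ss' then
    let ts := trim ss' in if nilp s && nilp ts then [::] else s :: ts
  else [::].

Fixpoint norm (r : rawdom) : rawdom :=
  let: RawDom ss := r in
  RawDom (trim [seq sort raw_le [seq norm x | x <- s] | s <- ss]).

Lemma trim_id (T : Type) (ss : seq (seq T)) : trim (trim ss) = trim ss.
Proof. by elim: ss => //= s ss IH; case: ifP => //= h; rewrite IH h. Qed.

Lemma nth_trim (T : Type) (ss : seq (seq T)) i :
  nth [::] (trim ss) i = nth [::] ss i.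
Proof.
elim: ss i => //= s ss IH [|i] /=; case: ifP => //= /andP[/nilP hs /nilP h].
  by rewrite hs.
by rewrite -IH h nth_nil.
Qed.

Lemma trim_sub (T : eqType) (ss : seq (seq T)) : {subset trim ss <= ss}.
Proof.
elim: ss => //= s ss IH t; case: ifP => // _.
by rewrite !inE => /orP[->//|/IH ->]; rewrite orbT.
Qed.

Lemma norm_id r : norm (norm r) = norm r.
Proof.
elim/rawdom_ind_in: r => ss IH /=; congr RawDom.
rewrite (_ : map _ (trim _) =
  trim [seq sort raw_le [seq norm x | x <- s] | s <- ss]) ?trim_id //.
apply: map_id_in => t /trim_sub /mapP[s s_ss ->].
rewrite (@map_id_in _ norm).
  exact/sorted_sort/sort_sorted/raw_le_total/raw_le_trans.
by move=> x; rewrite mem_sort => /mapP[y y_s ->]; apply: IH s_ss y_s.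
Qed.

Record dom : Type := Dom { raw_of : rawdom; _ : norm raw_of == raw_of }.
HB.instance Definition _ := [isSub for raw_of].
HB.instance Definition _ := [Countable of dom by <:].

Definition dom_of (r : rawdom) : dom := Dom (introT eqP (norm_id r)).

Local Open Scope mset_scope.

(* The sequence ([], [], ...). *)
Definition star : dom := dom_of (RawDom [::]).

(* The sequence a :: alpha. *)
Definition dcons (a : {mset dom}) (alpha : dom) : dom :=
  dom_of (RawDom (map raw_of (enum_mset a) :: rawseq (raw_of alpha))).

Definition entry (alpha : dom) (i : nat) : {mset dom} :=
  seq_mset (map dom_of (nth [::] (rawseq (raw_of alpha)) i)).

Lemma raw_ofK : cancel raw_of dom_of.
Proof. by move=> [r r_norm]; apply: val_inj; exact/eqP. Qed.

Lemma norm_raw alpha : norm (raw_of alpha) = raw_of alpha.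
Proof. by case: alpha => r /= /eqP. Qed.

Lemma dom_of_norm r : dom_of (norm r) = dom_of r.
Proof. by apply: val_inj; rewrite /= norm_id. Qed.

Lemma entry_dom_of ss i :
  entry (dom_of (RawDom ss)) i = seq_mset (map dom_of (nth [::] ss i)).
Proof.
rewrite /entry /= nth_trim; case: (ltnP i (size ss)) => h; last first.
  by rewrite !nth_default ?size_map.
rewrite (nth_map [::]) //; apply/eq_seq_msetP.
rewrite (perm_trans (perm_map _ (permEl (perm_sort _ _)))) // -map_comp.
by rewrite (eq_map (g := dom_of)) // => r; exact: dom_of_norm.
Qed.

Lemma entry_star i : entry star i = mset0.
Proof. by rewrite entry_dom_of nth_nil /= -enum_mset0 seq_mset_id. Qed.

Lemma entry_dcons a alpha i :
  entry (dcons a alpha) i = if i is j.+1 then entry alpha j else a.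
Proof.
rewrite entry_dom_of; case: i => [|j] //=.
by rewrite -map_comp (eq_map (g := id)) ?map_id ?seq_mset_id //; exact: raw_ofK.
Qed.

Lemma entry_finite alpha : exists n, forall i, n <= i -> entry alpha i = mset0.
Proof.
exists (size (rawseq (raw_of alpha))) => i h.
by rewrite /entry nth_default // -(entry_star 0) entry_dom_of.
Qed.

Lemma trim_inj (T : Type) (ss ts : seq (seq T)) :
  (forall i, nth [::] ss i = nth [::] ts i) -> trim ss = trim ts.
Proof.
have nilE (us : seq (seq T)) : (forall i, nth [::] us i = [::]) -> trim us = [::].
  by elim: us => //= u us IH h; rewrite (IH (fun i => h i.+1)) (h 0 : u = _).
elim: ss ts => [|s ss IH] [|t ts] h //.
- by rewrite (nilE (t :: ts)) // => i; rewrite -h nth_nil.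
- by rewrite (nilE (s :: ss)) // => i; rewrite h nth_nil.
- by move: (h 0) => /= ->; rewrite (IH ts) // => i; exact: (h i.+1).
Qed.

Lemma dom_ext alpha beta : entry alpha =1 entry beta -> alpha = beta.
Proof.
move=> h; apply: val_inj; rewrite /= -(norm_raw alpha) -(norm_raw beta).
have {}h i : perm_eq (map dom_of (nth [::] (rawseq (raw_of alpha)) i))
                     (map dom_of (nth [::] (rawseq (raw_of beta)) i)).
  exact/eq_seq_msetP/h.
case: (raw_of alpha) (raw_of beta) h => [ss] [ts] /= h.
congr RawDom; apply: trim_inj => i.
have sortE us : nth [::] [seq sort raw_le [seq norm x | x <- s] | s <- us] i =
    sort raw_le [seq norm x | x <- nth [::] us i].
  case: (ltnP i (size us)) => k; first by rewrite (nth_map [::]).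
  by rewrite !nth_default ?size_map.
rewrite !sortE; apply/perm_sortP; [exact: raw_le_total|exact: raw_le_trans|
  exact: raw_le_anti|].
have /(perm_map raw_of) := h i.
by rewrite -!map_comp !(eq_map (g := norm)).
Qed.

Lemma dom_seq (f : nat -> {mset dom}) n :
  (forall i, n <= i -> f i = mset0) -> exists alpha, entry alpha =1 f.
Proof.
elim: n f => [|n IH] f f0; first by exists star => i; rewrite entry_star f0.
have [|alpha alphaE] := IH (fun i => f i.+1); first by move=> i; exact: f0 i.+1.
by exists (dcons (f 0) alpha) => -[|i]; rewrite entry_dcons //; exact: alphaE.
Qed.

Lemma dom_nested_ind (P : dom -> Prop) :
  (forall alpha, (forall i beta, beta \in entry alpha i -> P beta) -> P alpha) ->
  forall alpha, P alpha.
Proof.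
move=> hP alpha; rewrite -(raw_ofK alpha).
elim/rawdom_ind_in: (raw_of alpha) => ss IH; apply: hP => i beta.
rewrite entry_dom_of in_mset mset_seqE -has_count has_pred1.
move=> /mapP[r r_in ->]; apply: (IH (nth [::] ss i)) => //.
by apply: mem_nth; case: ltnP r_in => // h; rewrite nth_default.
Qed.

Definition mtup (n : nat) := n.-tuple {mset dom}.

Definition mtup0 n : mtup n := [tuple mset0 | i < n].
Definition mtup1 n (i : 'I_n) (alpha : dom) : mtup n :=
  [tuple if j == i then [mset alpha] else mset0 | j < n].
Definition mtupD n (a b : mtup n) : mtup n :=
  [tuple tnth a i `+` tnth b i | i < n].

Section Lists.
Variables (n : nat) (f : term -> mtup n -> dom -> Prop).

Fixpoint interp_bag_with (P : bag) (a : mtup n) (b : {mset dom}) : Prop :=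
  if P is L :: Q then
    exists a1 a2 beta b', [/\ a = mtupD a1 a2, b = beta +` b',
      f L a1 beta & interp_bag_with Q a2 b']
  else a = mtup0 n /\ b = mset0.

Fixpoint interp_test_with (V : test) (a : mtup n) : Prop :=
  if V is L :: W then
    exists a1 a2, [/\ a = mtupD a1 a2, f L a1 star & interp_test_with W a2]
  else a = mtup0 n.

End Lists.

(* In the clause for an abstraction, the bound variable has index 0 in the
   body, where each x_i of the list becomes x_(i+1). *)
Fixpoint interp (n : nat) (xs : n.-tuple nat) (M : term) (a : mtup n)
    (alpha : dom) {struct M} : Prop :=
  match M with
  | Var x => exists2 i : 'I_n, tnth xs i = x & a = mtup1 i alpha
  | Lam M => exists b beta, alpha = dcons b beta /\
      interp [tuple of rcons (map succn xs) 0] M [tuple of rcons a b] beta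
  | App M P => exists a1 a2 b, [/\ a = mtupD a1 a2,
      interp xs M a1 (dcons b alpha) & interp_bag_with (interp xs) P a2 b]
  | TBar V => alpha = star /\ interp_test_with (interp xs) V a
  end.

Definition interp_bag n (xs : n.-tuple nat) : bag -> mtup n -> {mset dom} -> Prop :=
  interp_bag_with (interp xs).
Definition interp_test n (xs : n.-tuple nat) : test -> mtup n -> Prop :=
  interp_test_with (interp xs).

(* Main.v *)
(* Reading environments as functions on all variables makes the semantics
   independent of the list of variables: by linearity the environment determines
   the free variables.  The semantics is compositional, hence monotone under
   contexts, and invariant under reduction.  Every reduction strictly decreases
   the size of each summand (a linear substitution consumes its argument, and
   {0/x} only selects), and a closed non-empty test is reducible, so that a closed
   test reduces to eps or to 0, to eps exactly when its interpretation is
   inhabited.  This gives one direction.  Conversely, by induction on alpha there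
   are closed bags Ps such that tau[M Ps] has the environments e with (e, alpha)
   in [[M]]; applied to M with its free variables abstracted, this separates. *)

Require Import Defs.
From mathcomp Require Import all_boot.
From mathcomp Require Import finmap multiset zify.
From Stdlib Require Import FunctionalExtensionality.

Set Implicit Arguments.
Unset Strict Implicit.
Unset Printing Implicit Defensive.

Local Open Scope mset_scope.

(** * Environments *)

Lemma term_ind_in (P : term -> Prop) :
  (forall x, P (Var x)) ->
  (forall M, P M -> P (Lam M)) ->
  (forall M Ls, P M -> (forall L, L \in Ls -> P L) -> P (App M Ls)) ->
  (forall Ls, (forall L, L \in Ls -> P L) -> P (TBar Ls)) ->
  forall M, P M.
Proof.
move=> hV hL hA hT.
have allP (Ls : seq term) :
    foldr (fun L => and (P L)) True Ls -> forall L, L \in Ls -> P L.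
  elim: Ls => //= L Ls IH [PL /IH h] L'; rewrite inE => /predU1P[->|/h] //.
elim/term_nested_ind => //.
- by move=> M Ls PM /allP; exact: hA.
- by move=> Ls /allP; exact: hT.
Qed.

Definition env := nat -> {mset dom}.
Definition env0 : env := fun=> mset0.
Definition envD (e1 e2 : env) : env := fun x => e1 x `+` e2 x.
Definition env1 (x : nat) (alpha : dom) : env :=
  fun y => if y == x then [mset alpha] else mset0.
Definition scons (b : {mset dom}) (e : env) : env :=
  fun x => if x is y.+1 then e y else b.

Lemma envDC e1 e2 : envD e1 e2 = envD e2 e1.
Proof. by apply: functional_extensionality => x; exact: msetDC. Qed.
Lemma envDA e1 e2 e3 : envD e1 (envD e2 e3) = envD (envD e1 e2) e3.
Proof. by apply: functional_extensionality => x; exact: msetDA. Qed.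
Lemma envDCA e1 e2 e3 : envD e1 (envD e2 e3) = envD e2 (envD e1 e3).
Proof. by apply: functional_extensionality => x; exact: msetDCA. Qed.
Lemma envDAC e1 e2 e3 : envD (envD e1 e2) e3 = envD (envD e1 e3) e2.
Proof. by apply: functional_extensionality => x; exact: msetDAC. Qed.
Lemma envD0 e : envD e env0 = e.
Proof. by apply: functional_extensionality => x; exact: msetD0. Qed.
Lemma env0D e : envD env0 e = e.
Proof. by apply: functional_extensionality => x; exact: mset0D. Qed.

Lemma msetD_eq0 (K : choiceType) (A B : {mset K}) :
  (A `+` B == mset0) = (A == mset0) && (B == mset0).
Proof.
apply/eqP/andP => [h|[/eqP-> /eqP->]]; last by rewrite msetD0.
by split; apply/eqP/msetP => x; move/msetP/(_ x): h; rewrite !msetE2 !mset0E;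
  case: (A x) (B x) => [|?] [].
Qed.

Lemma scons_eta e : scons (e 0) (fun x => e x.+1) = e.
Proof. by apply: functional_extensionality => -[]. Qed.
Lemma sconsD b1 b2 e1 e2 :
  scons (b1 `+` b2) (envD e1 e2) = envD (scons b1 e1) (scons b2 e2).
Proof. by apply: functional_extensionality => -[]. Qed.
Lemma scons_env1 x beta : scons mset0 (env1 x beta) = env1 x.+1 beta.
Proof. by apply: functional_extensionality => -[]. Qed.
Lemma scons_inj b1 b2 e1 e2 : scons b1 e1 = scons b2 e2 -> b1 = b2 /\ e1 = e2.
Proof.
move=> h; split; first by move/(congr1 (@^~ 0)): h.
by apply: functional_extensionality => x; move/(congr1 (@^~ x.+1)): h.
Qed.

Lemma msetDI (K : choiceType) (A B C : {mset K}) : A `+` C = B `+` C -> A = B.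
Proof. by move=> h; rewrite -(msetDKBC C A) h msetDKBC. Qed.

Lemma envDI e e1 e2 : envD e1 e = envD e2 e -> e1 = e2.
Proof.
move=> h; apply: functional_extensionality => x.
exact: msetDI (congr1 (@^~ x) h).
Qed.

Lemma env1_split x beta (a : env) :
  beta \in a x -> exists a', a = envD a' (env1 x beta).
Proof.
move=> h; exists (fun y => if y == x then a x `\ beta else a y).
apply: functional_extensionality => y; rewrite /envD /env1.
by case: eqP => [->|_]; rewrite ?msetD0 // msetDC msetB1K.
Qed.

(** The point [beta] at [x] lies in [a1] or in [a2], and can be cancelled there. This is the choice
    made by the sums in the definition of linear substitution. *)
Lemma envD_split x beta e a1 a2 : envD e (env1 x beta) = envD a1 a2 ->
  (exists2 a, a1 = envD a (env1 x beta) & e = envD a a2) \/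
  (exists2 a, a2 = envD a (env1 x beta) & e = envD a1 a).
Proof.
move=> h.
have: beta \in envD a1 a2 x by rewrite -h /envD /env1 eqxx in_msetD mset11 orbT.
rewrite /envD in_msetD => /orP[] /env1_split[a aE]; [left|right];
  exists a => //; apply: (@envDI (env1 x beta)).
- by rewrite h aE envDAC.
- by rewrite h aE envDA.
Qed.

Lemma dcons_inj a b alpha beta :
  dcons a alpha = dcons b beta -> a = b /\ alpha = beta.
Proof.
move=> h; split; first by rewrite -(entry_dcons a alpha 0) h entry_dcons.
apply: dom_ext => i.
by rewrite -(entry_dcons a alpha i.+1) h entry_dcons.
Qed.

(** This equation carries the soundness of the rules on tests: [star] is also a function point,
    whose argument is the empty multiset. *)
Lemma star_dcons : star = dcons mset0 star.
Proof. by apply: dom_ext => -[|i]; rewrite entry_dcons !entry_star. Qed.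

Lemma seq_mset_nil : seq_mset [::] = mset0 :> {mset dom}.
Proof. by apply/msetP => y; rewrite mset_seqE mset0E. Qed.

(** * Relational semantics *)

Section SemSeq.
Variable f : term -> env -> dom -> Prop.

Fixpoint sem_seq_with (P : seq term) (e : env) (bs : seq dom) : Prop :=
  match P, bs with
  | [::], [::] => e = env0
  | L :: Q, beta :: bs => exists e1 e2,
      [/\ e = envD e1 e2, f L e1 beta & sem_seq_with Q e2 bs]
  | _, _ => False
  end.
End SemSeq.

(* The relational semantics with environments indexed by all variables, so that
   it does not depend on a list of free variables; the elements of a bag are
   interpreted in order, the order being forgotten by [seq_mset]. *)
Fixpoint sem (M : term) (e : env) (alpha : dom) : Prop :=
  match M with
  | Var x => e = env1 x alpha
  | Lam M => exists b beta, alpha = dcons b beta /\ sem M (scons b e) beta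
  | App M P => exists e1 e2 bs, [/\ e = envD e1 e2,
      sem M e1 (dcons (seq_mset bs) alpha) & sem_seq_with sem P e2 bs]
  | TBar V => alpha = star /\
      exists2 bs, all (pred1 star) bs & sem_seq_with sem V e bs
  end.

Notation sem_seq := (sem_seq_with sem).

Definition sem_test (V : test) (e : env) : Prop :=
  exists2 bs, all (pred1 star) bs & sem_seq V e bs.

Lemma sem_seq_cat P Q e bs : sem_seq (P ++ Q) e bs <->
  exists e1 e2 bs1 bs2, [/\ e = envD e1 e2, bs = bs1 ++ bs2,
    sem_seq P e1 bs1 & sem_seq Q e2 bs2].
Proof.
elim: P e bs => [|L P IH] e bs /=; split.
- by move=> h; exists env0, e, [::], bs; rewrite env0D.
- by move=> [e1 [e2 [[|? ?] [bs2 [-> -> //= -> h]]]]]; rewrite env0D.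
- case: bs => // beta bs [e1 [e2 [-> h /IH]]].
  move=> [e3 [e4 [bs1 [bs2 [-> -> h1 h2]]]]].
  exists (envD e1 e3), e4, (beta :: bs1), bs2; rewrite envDA; split=> //.
  by exists e1, e3.
- move=> [e1 [e2 [[|beta bs1] [bs2 [-> -> //]]]]] [e3 [e4 [-> h1 h2 h3]]].
  exists e3, (envD e4 e2); rewrite envDA; split=> //; apply/IH.
  by exists e4, e2, bs1, bs2.
Qed.

Lemma sem_test_cat V W e : sem_test (V ++ W) e <->
  exists e1 e2, [/\ e = envD e1 e2, sem_test V e1 & sem_test W e2].
Proof.
split=> [[bs h /sem_seq_cat[e1 [e2 [bs1 [bs2 [-> bsE h1 h2]]]]]]|].
  move: h; rewrite bsE all_cat => /andP[b1 b2].
  by exists e1, e2; split=> //; [exists bs1|exists bs2].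
move=> [e1 [e2 [-> [bs1 b1 h1] [bs2 b2 h2]]]].
exists (bs1 ++ bs2); first by rewrite all_cat b1.
by apply/sem_seq_cat; exists e1, e2, bs1, bs2.
Qed.

Lemma sem_seq1 L e bs : sem_seq [:: L] e bs <->
  exists2 beta, bs = [:: beta] & sem L e beta.
Proof.
split=> [|[beta -> h]]; last by exists e, env0; rewrite envD0.
by case: bs => [|beta [|gamma bs]] //= [e1 [e2 [-> h // ->]]];
  exists beta; rewrite ?envD0.
Qed.

Lemma sem_test1 L e : sem_test [:: L] e <-> sem L e star.
Proof.
split=> [[bs bs_star /sem_seq1[beta bsE h]]|h].
  by move: bs_star h; rewrite bsE /= andbT => /eqP->.
by exists [:: star]; [|apply/sem_seq1; exists star].
Qed.

(* Resources are neither erased nor duplicated: the environment records exactly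
   the free variables. *)
Lemma sem_free M e alpha :
  sem M e alpha -> forall x, free x M = (e x != mset0).
Proof.
have env0E x : (env0 x != mset0) = false by rewrite eqxx.
have seqP P : (forall L, L \in P -> forall e alpha,
      sem L e alpha -> forall x, free x L = (e x != mset0)) ->
    forall e bs, sem_seq P e bs -> forall x, has (free x) P = (e x != mset0).
  elim: P => [|L P IH] h {}e [|beta bs] //=; first by move=> ->.
  move=> [e1 [e2 [-> hL hP]]] x; rewrite msetD_eq0 negb_and.
  rewrite (h L _ _ _ hL) ?mem_head // -(IH _ _ _ hP) // => L' L'P.
  by apply: h; rewrite inE L'P orbT.
elim/term_ind_in: M e alpha => [y|M IH|M P IHM IHP|V IH] e alpha /=.
- move=> -> x; rewrite /env1 (eq_sym y); case: eqP => // _; last by rewrite eqxx.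
  by apply/esym/eqP => /msetP/(_ alpha); rewrite msetnxx mset0E.
- by move=> [b [beta [_ /IH h]]] x; exact: h.
- move=> [e1 [e2 [bs [-> /IHM h1 /(seqP _ IHP) h2]]]] x.
  by rewrite h1 h2 msetD_eq0 negb_and.
- by move=> [_ [bs _ /(seqP _ IH)]].
Qed.

Lemma sem_seq_free P e bs :
  sem_seq P e bs -> forall x, has (free x) P = (e x != mset0).
Proof.
elim: P e bs => [|L P IH] e [|beta bs] //=; first by move=> -> x; rewrite eqxx.
move=> [e1 [e2 [-> hL hP]]] x.
by rewrite msetD_eq0 negb_and (sem_free hL) (IH _ _ hP).
Qed.

(** * Renaming of variables *)

(* [s] is a partial inverse of a renaming; [env_push s e] is the environment
   [e] transported along that renaming. *)
Definition env_push (s : nat -> option nat) (e : env) : env :=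
  fun y => if s y is Some x then e x else mset0.

Definition up_inv (s : nat -> option nat) (y : nat) : option nat :=
  if y is z.+1 then omap succn (s z) else Some 0.

Lemma env_pushD s e1 e2 :
  env_push s (envD e1 e2) = envD (env_push s e1) (env_push s e2).
Proof.
apply: functional_extensionality => y; rewrite /env_push /envD.
by case: (s y) => //; rewrite msetD0.
Qed.

Lemma env_push0 s : env_push s env0 = env0.
Proof. by apply: functional_extensionality => y; rewrite /env_push; case: s. Qed.

Lemma env_push_scons s b e :
  env_push (up_inv s) (scons b e) = scons b (env_push s e).
Proof.
by apply: functional_extensionality => -[|y] //=; rewrite /env_push /=; case: s.
Qed.

Lemma env_push1 (s : nat -> option nat) x y alpha :
  (forall z, (s z == Some x) = (z == y)) ->
  env_push s (env1 x alpha) = env1 y alpha.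
Proof.
move=> h; apply: functional_extensionality => z; rewrite /env_push /env1 -h.
by case: (s z).
Qed.

(** Restricted to a set of variables because a renaming such as [predn] in [zsubst] is injective
    only away from index 0. *)
Definition inv_on (r : nat -> nat) (s : nat -> option nat) (p : pred nat) :=
  forall x, p x -> forall y, (s y == Some x) = (y == r x).

Lemma inv_on_up r s M :
  inv_on r s (free^~ (Lam M)) -> inv_on (up r) (up_inv s) (free^~ M).
Proof.
move=> h [|x] Mx [|y] //=; first by case: (s y).
by rewrite eqSS -(h x Mx y); case: (s y).
Qed.

Lemma sem_ren_seq r s P :
  (forall L, L \in P -> forall e alpha, sem (ren r L) e alpha <->
     exists2 e', sem L e' alpha & e = env_push s e') ->
  forall e bs, sem_seq (map (ren r) P) e bs <->
    exists2 e', sem_seq P e' bs & e = env_push s e'.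
Proof.
elim: P => [|L P IH] h e [|beta bs] /=; try by split=> // -[].
  by split=> [->|[_ -> ->]]; [exists env0|]; rewrite ?env_push0.
have {}IH := IH (fun L' L'P => h L' (mem_behead (s := L :: P) L'P)).
have {}h := h L (mem_head _ _).
split=> [[e1 [e2 [-> /h[e1' h1 ->] /IH[e2' h2 ->]]]]|].
  by exists (envD e1' e2'); [exists e1', e2' | rewrite env_pushD].
move=> [_ [e1 [e2 [-> h1 h2]]] ->]; rewrite env_pushD.
exists (env_push s e1), (env_push s e2); split=> //.
- by apply/h; exists e1.
- by apply/IH; exists e2.
Qed.

(** An environment is pushed forward along the renaming; under a binder the inverse [s] lifts to
    [up_inv s]. The shift, the substitution of 0 and the named abstraction are all instances. *)
Lemma sem_ren r s M e alpha : inv_on r s (free^~ M) ->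
  sem (ren r M) e alpha <-> exists2 e', sem M e' alpha & e = env_push s e'.
Proof.
elim/term_ind_in: M r s e alpha => [x|M IH|M P IHM IHP|V IH] r s e alpha rs /=.
- have h := env_push1 alpha (rs x (eqxx x)).
  by split=> [->|[_ -> ->]] //; exists (env1 x alpha).
- have {}IH := IH _ _ _ _ (inv_on_up rs); split.
    move=> [b [beta [-> /IH[e' h]]]].
    rewrite -(scons_eta e') env_push_scons => /scons_inj[-> ->].
    by exists (fun x => e' x.+1) => //; exists (e' 0), beta; rewrite scons_eta.
  move=> [e' [b [beta [-> h]]] ->]; exists b, beta; split=> //; apply/IH.
  by exists (scons b e'); rewrite ?env_push_scons.
- have hM e' beta : sem (ren r M) e' beta <-> _ :=
    IHM r s e' beta (fun x h => rs x (introT orP (or_introl h))).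
  have /sem_ren_seq hP : forall L, L \in P -> forall e' beta,
      sem (ren r L) e' beta <-> exists2 e2, sem L e2 beta & e' = env_push s e2.
    move=> L LP e' beta; apply: IHP => // x Lx; apply: rs => /=.
    by apply/orP; right; apply/hasP; exists L.
  split=> [[e1 [e2 [bs [-> /hM[e1' h1 ->] /hP[e2' h2 ->]]]]]|].
    by exists (envD e1' e2'); [exists e1', e2', bs | rewrite env_pushD].
  move=> [_ [e1 [e2 [bs [-> h1 h2]]]] ->]; rewrite env_pushD.
  exists (env_push s e1), (env_push s e2), bs; split=> //.
  + by apply/hM; exists e1.
  + by apply/hP; exists e2.
- have /sem_ren_seq hV : forall L, L \in V -> forall e' beta,
      sem (ren r L) e' beta <-> exists2 e2, sem L e2 beta & e' = env_push s e2.
    move=> L LV e' beta; apply: IH => // x Lx; apply: rs => /=.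
    by apply/hasP; exists L.
  split=> [[-> [bs b /hV[e' h ->]]]|[e' [-> [bs b h]] ->]].
    by exists e' => //; split=> //; exists bs.
  by split=> //; exists bs => //; apply/hV; exists e'.
Qed.

Definition pred_opt (y : nat) : option nat := if y is x.+1 then Some x else None.

Lemma env_push_pred e : env_push pred_opt e = scons mset0 e.
Proof. by apply: functional_extensionality => -[]. Qed.

Lemma sem_shift M e alpha : sem (shift M) e alpha <->
  exists2 e', sem M e' alpha & e = scons mset0 e'.
Proof.
rewrite /shift (@sem_ren _ pred_opt); last by move=> x _ [].
by split=> -[e' h ->]; exists e'; rewrite ?env_push_pred.
Qed.

Lemma sem_seq_shift P e bs : sem_seq (map shift P) e bs <->
  exists2 e', sem_seq P e' bs & e = scons mset0 e'.
Proof.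
rewrite (@sem_ren_seq _ pred_opt); last first.
  by move=> L _ e' alpha; apply: sem_ren => x _ [].
by split=> -[e' h ->]; exists e'; rewrite ?env_push_pred.
Qed.

Definition sem_bag (P : bag) (e : env) (b : {mset dom}) : Prop :=
  exists2 bs, seq_mset bs = b & sem_seq P e bs.

Lemma sem_bagI P e bs : sem_seq P e bs -> sem_bag P e (seq_mset bs).
Proof. by exists bs. Qed.

(** Whether all points equal [star] depends only on the multiset of points, so a test may be
    compared as a bag. *)
Lemma sem_test_of_bag V V' :
  (forall e b, sem_bag V e b -> sem_bag V' e b) ->
  forall e, sem_test V e -> sem_test V' e.
Proof.
move=> h e [bs bs_star /sem_bagI/h[bs' /eq_seq_msetP bsE hV']].
by exists bs'; rewrite // (perm_all _ bsE).
Qed.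

(** Packages a summand as the existential to which the equivalences on sums apply. *)
Lemma mem_sem (S : seq term) e alpha M : M \in S -> sem M e alpha ->
  exists2 M', M' \in S & sem M' e alpha.
Proof. by exists M. Qed.

Lemma mem_sem_seq (S : seq bag) e bs P : P \in S -> sem_seq P e bs ->
  exists2 P', P' \in S & sem_seq P' e bs.
Proof. by exists P. Qed.

(** * Soundness *)

Scheme eqv_mut := Minimality for eqv Sort Prop
  with eqvs_mut := Minimality for eqvs Sort Prop.
Combined Scheme eqv_eqvs_ind from eqv_mut, eqvs_mut.

(** For bags the claim is about [sem_bag]: swapping two elements permutes the list of points and
    preserves only its multiset. *)
Lemma sem_eqv_eqvs :
  (forall M M', eqv M M' -> forall e alpha, sem M e alpha <-> sem M' e alpha) /\
  (forall P P', eqvs P P' ->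
     forall e b, sem_bag P e b <-> sem_bag P' e b).
Proof.
apply: eqv_eqvs_ind => //.
- by move=> M M' _ IH e alpha /=;
    split=> -[b [beta [-> h]]]; exists b, beta; split=> //; apply/IH.
- move=> M M' P P' _ IHM _ IHP e alpha /=; split.
    move=> [e1 [e2 [bs [-> /IHM h1 h2]]]].
    have /IHP[bs' bsE h2'] := sem_bagI h2.
    by exists e1, e2, bs'; rewrite bsE.
  move=> [e1 [e2 [bs [-> /IHM h1 h2]]]].
  have /IHP[bs' bsE h2'] := sem_bagI h2.
  by exists e1, e2, bs'; rewrite bsE.
- move=> V V' _ IH e alpha /=; split=> -[->].
    by move=> /(sem_test_of_bag (fun e b => proj1 (IH e b))).
  by move=> /(sem_test_of_bag (fun e b => proj2 (IH e b))).
- move=> L L' P P' _ IHL _ IHP e b.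
  split=> -[[|beta bs] <-] //= [e1 [e2 [-> /IHL h1 h2]]];
    have /IHP[bs' bsE h2'] := sem_bagI h2;
    exists (beta :: bs'); rewrite ?mset_cons ?bsE //; by exists e1, e2.
- have swap L1 L2 P e b :
      sem_bag [:: L1, L2 & P] e b -> sem_bag [:: L2, L1 & P] e b.
    move=> [[|beta [|gamma bs]] <-] //=; first by move=> [? [? []]].
    move=> [e1 [_ [-> h1 [e2 [e3 [-> h2 h3]]]]]].
    exists [:: gamma, beta & bs]; first by rewrite !mset_cons msetDCA.
    exists e2, (envD e1 e3); rewrite envDCA; split=> //.
    by exists e1, e3.
  by move=> L1 L2 P e b; split; exact: swap.
- by move=> P Q S _ h1 _ h2 e b; rewrite h1.
Qed.

Lemma sem_test_eqvs V V' e : eqvs V V' -> sem_test V e <-> sem_test V' e.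
Proof.
move=> /(proj2 sem_eqv_eqvs) h.
by split; apply: sem_test_of_bag => {}e b /h.
Qed.

(** * Linear substitution and the substitution of 0 *)

(** The point [beta] at [x] belongs to the environment of one element, and the summand that
    substitutes in this element accounts for it. The empty list has no point to give, matching the
    empty sum. Here [F] and [Q] stand for linear substitution of a term and for the semantics of
    that term. *)
Lemma sem_sum_at_one x (F : term -> seq term) (Q : env -> dom -> Prop) P :
  (forall L, L \in P -> forall e alpha,
     (exists2 L', L' \in F L & sem L' e alpha) <->
     exists e1 e2 beta, [/\ e = envD e1 e2, Q e2 beta &
       sem L (envD e1 (env1 x beta)) alpha]) ->
  forall e bs, (exists2 P', P' \in sum_at_one F P & sem_seq P' e bs) <->
    exists e1 e2 beta, [/\ e = envD e1 e2, Q e2 beta &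
      sem_seq P (envD e1 (env1 x beta)) bs].
Proof.
elim: P => [|L P IH] h e bs /=.
  split=> [[? //]|[e1 [e2 [beta [_ _]]]]]; case: bs => // /(congr1 (@^~ x)).
  rewrite /envD /env1 eqxx => /eqP; rewrite msetD_eq0 => /andP[_] /eqP.
  by move=> /msetP/(_ beta); rewrite msetnxx mset0E.
have {}IH := IH (fun L' L'P => h L' (mem_behead (s := L :: P) L'P)).
have {}h := h L (mem_head _ _).
split=> [[P']|].
  rewrite mem_cat => /orP[] /mapP[]; last first.
    move=> P1 P1P ->; case: bs => //= gamma bs [e1 [e2 [-> h1 h2]]].
    have /IH[e3 [e4 [beta [-> h3 h4]]]] := mem_sem_seq P1P h2.
    exists (envD e1 e3), e4, beta; rewrite envDA; split=> //.
    by exists e1, (envD e3 (env1 x beta)); rewrite envDA.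
  move=> L1 L1L ->; case: bs => //= gamma bs [e1 [e2 [-> h1 h2]]].
  have /h[e3 [e4 [beta [-> h3 h4]]]] := mem_sem L1L h1.
  exists (envD e3 e2), e4, beta; rewrite envDAC; split=> //.
  by exists (envD e3 (env1 x beta)), e2; rewrite envDAC.
move=> [e1 [e2 [beta [-> Qb]]]]; case: bs => //= gamma bs.
move=> [e3 [e4 [/envD_split[[a -> ->]|[a -> ->]] h3 h4]]].
  have /h[L' L'L h'] : exists e1 e5 beta', [/\ envD a e2 = envD e1 e5,
    Q e5 beta' & sem L (envD e1 (env1 x beta')) gamma] by exists a, e2, beta.
  exists (L' :: P); first by rewrite mem_cat map_f.
  by exists (envD a e2), e4; rewrite envDAC.
have /IH[P' P'P h'] : exists e1 e5 beta', [/\ envD a e2 = envD e1 e5,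
  Q e5 beta' & sem_seq P (envD e1 (env1 x beta')) bs] by exists a, e2, beta.
exists (L :: P'); first by rewrite mem_cat map_f ?orbT.
by exists e3, (envD a e2); rewrite envDA.
Qed.

(** Linear substitution trades one point [beta] of [x] for an environment [e2] in which [N] has the
    point [beta]; [x] may keep further points in [e1] and [e2]. *)
Lemma sem_lsubst x N M e alpha :
  (exists2 M', M' \in lsubst x N M & sem M' e alpha) <->
  exists e1 e2 beta, [/\ e = envD e1 e2, sem N e2 beta &
    sem M (envD e1 (env1 x beta)) alpha].
Proof.
elim/term_ind_in: M x N e alpha => [y|M IH|M P IHM IHP|V IH] x N e alpha /=.
- split=> [[M']|[e1 [e2 [beta [-> hN h]]]]].
    case: (y =P x) => [->|//]; rewrite inE => /eqP-> h.
    by exists env0, e, alpha; rewrite !env0D.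
  (* The environment [env1 y alpha] has a single point, which must be [beta] at [x]. *)
  have [yx ab] : x = y /\ beta = alpha.
    move/(congr1 (@^~ x)): (h); rewrite /envD /env1 eqxx => /msetP/(_ beta).
    rewrite msetE2 msetnxx addn1; case: (x =P y) => [->|_]; last by rewrite mset0E.
    by rewrite msetnE; case: (beta =P alpha).
  move: h; rewrite yx ab -{2}[env1 y alpha]env0D => /envDI->.
  by exists N; rewrite ?eqxx ?mem_head // env0D -ab.
- split=> [[_ /mapP[M' M'M ->] /= [b [beta [-> h]]]]|].
    have /IH[e1 [e0 [gamma [eE /sem_shift[e2 hN e0E] hM]]]] :=
      mem_sem M'M h.
    (* The shifted [N] has no point at index 0, so all of [b] comes from [e1]. *)
    move: eE hM; rewrite e0E -(scons_eta e1) -sconsD msetD0.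
    move=> /scons_inj[-> ->]; rewrite -scons_env1 -sconsD msetD0 => hM.
    exists (fun x => e1 x.+1), e2, gamma; split=> //.
    by exists (e1 0), beta.
  move=> [e1 [e2 [gamma [-> hN [b [beta [-> h]]]]]]].
  have /IH[M' M'M h'] : exists e3 e4 gamma,
      [/\ scons b (envD e1 e2) = envD e3 e4, sem (shift N) e4 gamma &
        sem M (envD e3 (env1 x.+1 gamma)) beta].
    exists (scons b e1), (scons mset0 e2), gamma.
    rewrite -scons_env1 -!sconsD !msetD0; split=> //.
    by apply/sem_shift; exists e2.
  by exists (Lam M'); [rewrite map_f | exists b, beta].
- have hP := sem_sum_at_one (fun L LP => IHP L LP x N).
  split=> [[M']|].
    rewrite mem_cat => /orP[] /mapP[M1 M1M -> /=] [e1 [e2 [bs [-> h1 h2]]]].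
      have /IHM[e3 [e4 [gamma [-> hN hM]]]] := mem_sem M1M h1.
      exists (envD e3 e2), e4, gamma; rewrite envDAC; split=> //.
      by exists (envD e3 (env1 x gamma)), e2, bs; rewrite envDAC.
    have /hP[e3 [e4 [gamma [-> hN hM]]]] := mem_sem_seq M1M h2.
    exists (envD e1 e3), e4, gamma; rewrite envDA; split=> //.
    by exists e1, (envD e3 (env1 x gamma)), bs; rewrite envDA.
  move=> [e1 [e2 [gamma [-> hN]]]] [e3 [e4 [bs []]]].
  move=> /envD_split[[a -> ->]|[a -> ->]] h3 h4.
    have /IHM[M' M'M h'] : exists e1 e5 gamma', [/\ envD a e2 = envD e1 e5,
        sem N e5 gamma' &
        sem M (envD e1 (env1 x gamma')) (dcons (seq_mset bs) alpha)].
      by exists a, e2, gamma.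
    exists (App M' P); first by rewrite mem_cat map_f.
    by exists (envD a e2), e4, bs; rewrite envDAC.
  have /hP[P' P'P h'] : exists e1 e5 gamma', [/\ envD a e2 = envD e1 e5,
      sem N e5 gamma' & sem_seq P (envD e1 (env1 x gamma')) bs].
    by exists a, e2, gamma.
  exists (App M P'); first by rewrite mem_cat map_f ?orbT.
  by exists e3, (envD a e2), bs; rewrite envDA.
- have hV := sem_sum_at_one (fun L LV => IH L LV x N).
  split=> [[_ /mapP[V' V'V ->] /= [-> [bs b h]]]|].
    have /hV[e1 [e2 [gamma [-> hN h']]]] := mem_sem_seq V'V h.
    by exists e1, e2, gamma; split=> //; split=> //; exists bs.
  move=> [e1 [e2 [gamma [-> hN [-> [bs b h]]]]]].
  have /hV[V' V'V h'] : exists e3 e5 gamma', [/\ envD e1 e2 = envD e3 e5,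
      sem N e5 gamma' & sem_seq V (envD e3 (env1 x gamma')) bs].
    by exists e1, e2, gamma.
  by exists (TBar V'); [rewrite map_f | split=> //; exists bs].
Qed.

Definition envn (x : nat) (b : {mset dom}) : env :=
  fun y => if y == x then b else mset0.

Lemma scons_envn b e : scons b e = envD (scons mset0 e) (envn 0 b).
Proof.
by apply: functional_extensionality => -[|x]; rewrite /envD /= ?mset0D ?msetD0.
Qed.

Lemma envnD x b1 b2 : envD (envn x b1) (envn x b2) = envn x (b1 `+` b2).
Proof.
apply: functional_extensionality => y; rewrite /envD /envn.
by case: eqP; rewrite // msetD0.
Qed.

Lemma envn0 x : envn x mset0 = env0.
Proof.
by apply: functional_extensionality => y; rewrite /envn; case: eqP.
Qed.

(** As [a2] has no point at [x], all of [b] lies in [a1], and the case distinction of [envD_split]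
    disappears. *)
Lemma envn_split x b e a1 a2 :
  envD e (envn x b) = envD a1 a2 -> a2 x = mset0 ->
  exists2 a, a1 = envD a (envn x b) & e = envD a a2.
Proof.
move=> h a2x; exists (fun y => if y == x then e x else a1 y);
  apply: functional_extensionality => y; move/(congr1 (@^~ y)): h;
  rewrite /envD /envn; case: eqP => [->|_] //; rewrite ?a2x ?msetD0 //.
Qed.

(** Each element of [P] consumes one point of [x]. As [x] is not free in [P], none of these points
    lies in the environment of an element substituted earlier. *)
Lemma sem_lsubst_bag x P M e alpha : ~~ has (free x) P ->
  (exists2 M', M' \in lsubst_bag x P M & sem M' e alpha) <->
  exists e1 e2 bs, [/\ e = envD e1 e2, sem_seq P e2 bs &
    sem M (envD e1 (envn x (seq_mset bs))) alpha].
Proof.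
rewrite /lsubst_bag => xP.
(* The fold accumulates a sum, so the induction is on an arbitrary starting sum [S]. *)
suff foldP (S : seq term) e' :
    (exists2 M', M' \in foldl (fun S L => flatten [seq lsubst x L A | A <- S]) S P
       & sem M' e' alpha) <->
    exists e1 e2 bs, [/\ e' = envD e1 e2, sem_seq P e2 bs &
      exists2 A, A \in S & sem A (envD e1 (envn x (seq_mset bs))) alpha].
  rewrite foldP; split=> -[e1 [e2 [bs [-> h1]]]].
    by case=> A; rewrite inE => /eqP-> h2; exists e1, e2, bs.
  by move=> h2; exists e1, e2, bs; split=> //; exists M; rewrite ?mem_head.
elim: P xP S e' => [|L P IH] /= xP S e'.
  split=> [h|[e1 [e2 [[|? ?] [-> //= -> h]]]]]; last first.
    by rewrite envD0; move: h; rewrite seq_mset_nil envn0 envD0.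
  by exists e', env0, [::]; rewrite seq_mset_nil envn0 !envD0.
move: xP; rewrite negb_or => /andP[xL xP]; rewrite (IH xP).
split=> [[e1 [e2 [bs [-> h1 [A1 /flattenP[_ /mapP[A AS ->] A1A] hA1]]]]]|].
  have /sem_lsubst[e3 [e4 [beta [eE hL hA]]]] := mem_sem A1A hA1.
  have e4x : e4 x = mset0 by apply/eqP; rewrite -[_ == _]negbK -(sem_free hL).
  have [a aE ->] := envn_split eE e4x.
  exists a, (envD e4 e2), (beta :: bs); rewrite envDA; split=> //.
    by exists e4, e2.
  exists A => //; move: hA; rewrite aE mset_cons -envnD -envDA.
  by rewrite (envDC (env1 _ _)).
move=> [e1 [_ [[|beta bs] [-> //]]]] [e2 [e3 [-> hL hP]]] [A AS hA].
exists (envD e1 e2), e3, bs; rewrite -envDA; split=> //.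
have [|A1 A1A hA1] := proj2 (sem_lsubst x L A (envD (envD e1 e2)
  (envn x (seq_mset bs))) alpha).
  exists (envD e1 (envn x (seq_mset bs))), e2, beta; rewrite envDAC; split=> //.
  by move: hA; rewrite mset_cons -envnD envDA envDAC.
by exists A1 => //; apply/flattenP; exists (lsubst x L A); rewrite ?map_f.
Qed.

(** By [sem_free], the environment is empty at index 0 exactly when this index is not free in [M],
    which is when [zsubst] keeps the term. *)
Lemma sem_zsubst M e alpha :
  (exists2 M', M' \in zsubst M & sem M' e alpha) <-> sem M (scons mset0 e) alpha.
Proof.
have renP : ~~ free 0 M -> inv_on predn (fun y => Some y.+1) (free^~ M).
  by move=> M0 [|x] Mx y //; move: M0; rewrite Mx.
have pushE e' : env_push (fun y => Some y.+1) e' = fun y => e' y.+1 by [].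
rewrite /zsubst; split=> [[M']|h].
  case: ifPn => // M0; rewrite inE => /eqP-> /(sem_ren _ _ (renP M0)).
  move=> [e' h ->]; rewrite pushE; suff <- : e' 0 = mset0 by rewrite scons_eta.
  by apply/eqP; rewrite -[_ == _]negbK -(sem_free h).
have M0 : ~~ free 0 M by rewrite (sem_free h) /= eqxx.
rewrite (negPf M0); exists (ren predn M); rewrite ?mem_head //.
by apply/(sem_ren _ _ (renP M0)); exists (scons mset0 e).
Qed.

Lemma free_ren r M y : free y (ren r M) -> exists2 x, free x M & y = r x.
Proof.
have hasP P : (forall L, L \in P -> forall r y, free y (ren r L) ->
      exists2 x, free x L & y = r x) -> forall r y,
    has (free y) (map (ren r) P) -> exists2 x, has (free x) P & y = r x.
  move=> h r' y' /hasP[_ /mapP[L LP ->]] /(h L LP)[x Lx ->].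
  by exists x => //; apply/hasP; exists L.
elim/term_ind_in: M r y => [x|M IH|M P IHM IHP|V IH] r y /=.
- by move=> /eqP<-; exists x.
- by move=> /IH[[//|x] Mx [->]]; exists x.
- move=> /orP[/IHM[x Mx ->]|/(hasP _ IHP)[x Px ->]];
    by exists x; rewrite // ?Mx ?Px ?orbT.
- exact: hasP.
Qed.

Lemma has_free_shift P : ~~ has (free 0) (map shift P).
Proof. by apply/hasP => -[_ /mapP[L _ ->]] /free_ren[]. Qed.

(** The points of the bound variable are exactly those of the bag: [lsubst_bag] consumes one for
    each element, and [zsubst] then demands that none is left. *)
Lemma sem_beta M P e alpha :
  sem (App (Lam M) P) e alpha <-> exists2 M', M' \in beta M P & sem M' e alpha.
Proof.
split=> [[e1 [e2 [bs [-> [b [beta [/dcons_inj[<- <-]]]]]]]]|].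
  rewrite scons_envn => hM hP.
  have [|M1 M1M] := proj2 (sem_lsubst_bag M (scons mset0 (envD e1 e2)) alpha
    (has_free_shift P)).
    exists (scons mset0 e1), (scons mset0 e2), bs.
    rewrite -sconsD msetD0; split=> //.
    by apply/sem_seq_shift; exists e2.
  move=> /sem_zsubst[M' M'M h']; exists M' => //.
  by apply/flattenP; exists (zsubst M1); rewrite ?map_f.
move=> [M' /flattenP[_ /mapP[M1 M1M ->] M'M1] h'].
have /sem_zsubst h1 := mem_sem M'M1 h'.
have /(sem_lsubst_bag _ _ _ (has_free_shift P))[e1 [e2 [bs [eE h2 hM]]]] :=
  mem_sem M1M h1.
move: eE hM; have /sem_seq_shift[e2' hP ->] := h2.
rewrite -(scons_eta e1) -sconsD => /scons_inj[+ ->].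
rewrite msetD0 => <-; rewrite -scons_envn => hM.
exists (fun x => e1 x.+1), e2', bs; split=> //.
by exists (seq_mset bs), alpha.
Qed.

(* Invariance under reduction *)
Scheme red_tm_mut := Minimality for red_tm Sort Prop
  with red_bag_mut := Minimality for red_bag Sort Prop
  with red_test_mut := Minimality for red_test Sort Prop.
Combined Scheme red_ind from red_tm_mut, red_bag_mut, red_test_mut.

Lemma sem_seq_elt P L (Ls : seq term) Q e bs :
  (forall e alpha, sem L e alpha <-> exists2 L', L' \in Ls & sem L' e alpha) ->
  sem_seq (P ++ L :: Q) e bs <->
  exists2 P', P' \in [seq P ++ L' :: Q | L' <- Ls] & sem_seq P' e bs.
Proof.
move=> h; split=> [|[_ /mapP[L' L'L ->]]] /sem_seq_cat.
  move=> [e1 [e2 [bs1 [[|gamma bs2] [-> -> h1]]]]] //=.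
  move=> [e3 [e4 [-> /h[L' L'L hL'] h4]]].
  exists (P ++ L' :: Q); first by apply/mapP; exists L'.
  apply/sem_seq_cat; exists e1, (envD e3 e4), bs1, (gamma :: bs2); split=> //.
  by exists e3, e4.
move=> [e1 [e2 [bs1 [[|gamma bs2] [-> -> h1]]]]] //= [e3 [e4 [-> hL' h4]]].
apply/sem_seq_cat; exists e1, (envD e3 e4), bs1, (gamma :: bs2); split=> //.
by exists e3, e4; split=> //; apply/h; exists L'.
Qed.

Lemma sem_test_cons L W e : sem_test (L :: W) e <->
  exists e1 e2, [/\ e = envD e1 e2, sem L e1 star & sem_test W e2].
Proof.
rewrite -cat1s sem_test_cat.
by split=> -[e1 [e2 [-> /sem_test1 h1 h2]]]; exists e1, e2.
Qed.

(** A reduction in a bag replaces an element in place, so the list of points is kept. A reduction in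
    a test may change the number of elements, so there only the environment is compared. *)
Lemma sem_red :
  (forall M Ms, red_tm M Ms -> forall e alpha,
     sem M e alpha <-> exists2 M', M' \in Ms & sem M' e alpha) /\
  (forall P Ps, red_bag P Ps -> forall e bs,
     sem_seq P e bs <-> exists2 P', P' \in Ps & sem_seq P' e bs) /\
  (forall V Vs, red_test V Vs -> forall e,
     sem_test V e <-> exists2 V', V' \in Vs & sem_test V' e).
Proof.
apply: red_ind.
- exact: sem_beta.
- move=> V e alpha; split=> [[e1 [e2 [[|? ?] [-> h //= ->]]]]|].
    exists (TBar V); rewrite ?mem_head // envD0.
    case: h => + [bs b h]; rewrite star_dcons => /dcons_inj[_ ->].
    by split=> //; exists bs.
  move=> [_ /[!inE] /eqP-> [-> [bs b h]]].
  exists e, env0, [::]; rewrite envD0; split=> //; split; last by exists bs.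
  by rewrite [RHS]star_dcons seq_mset_nil.
(* A nonempty bag has a nonempty multiset of points, whereas the first entry of [star] is empty. *)
- move=> V L P e alpha; split=> [|[//]] [e1 [e2 [[|beta bs] [_ [+ _]]]]] //.
  rewrite star_dcons => /dcons_inj[/msetP/(_ beta)].
  by rewrite mset_cons mset1DE eqxx mset0E.
- move=> M Ms _ IH e alpha; split=> [[b [beta [-> /IH[M' M'M h]]]]|].
    by exists (Lam M'); [rewrite map_f | exists b, beta].
  move=> [_ /mapP[M' M'M ->] [b [beta [-> h]]]]; exists b, beta; split=> //.
  by apply/IH; exists M'.
- move=> M Ms P _ IH e alpha; split=> [[e1 [e2 [bs [-> /IH[M' M'M h] hP]]]]|].
    by exists (App M' P); [rewrite map_f | exists e1, e2, bs].
  move=> [_ /mapP[M' M'M ->] [e1 [e2 [bs [-> h hP]]]]].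
  by exists e1, e2, bs; split=> //; apply/IH; exists M'.
- move=> M P Ps _ IH e alpha; split=> [[e1 [e2 [bs [-> hM /IH[P' P'P h]]]]]|].
    by exists (App M P'); [rewrite map_f | exists e1, e2, bs].
  move=> [_ /mapP[P' P'P ->] [e1 [e2 [bs [-> h hP]]]]].
  by exists e1, e2, bs; split=> //; apply/IH; exists P'.
- move=> V Vs _ IH e alpha; split=> [[-> h]|].
    by have /IH[V' V'V h'] := h; exists (TBar V'); [rewrite map_f|].
  move=> [_ /mapP[V' V'V ->] [-> h]]; split=> //.
  by apply/IH; exists V'.
- by move=> P L Ls Q _ IH e bs; exact: sem_seq_elt.
- move=> V M W e.
  (* Read as [dcons mset0 star], the point [star] leaves the bound variable empty, which is what
     [zsubst] selects. *)
  have lamE e' : sem (Lam M) e' star <-> exists2 M', M' \in zsubst M & sem M' e' star.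
    rewrite sem_zsubst; split=> [[b [beta []]]|h].
      by rewrite {1}star_dcons => /dcons_inj[<- <-].
    by exists mset0, star; rewrite -star_dcons.
  split=> [/sem_test_cat[e1 [e2 [-> h1 /sem_test_cons]]]|].
    move=> [e3 [e4 [-> /lamE[M' M'M h3] h4]]].
    exists (V ++ M' :: W); first by apply/mapP; exists M'.
    apply/sem_test_cat; exists e1, (envD e3 e4); split=> //.
    by apply/sem_test_cons; exists e3, e4.
  move=> [_ /mapP[M' M'M ->]] /sem_test_cat[e1 [e2 [-> h1 /sem_test_cons]]].
  move=> [e3 [e4 [-> h3 h4]]]; apply/sem_test_cat; exists e1, (envD e3 e4).
  split=> //; apply/sem_test_cons; exists e3, e4; split=> //.
  by apply/lamE; exists M'.
- move=> V U W e; split=> [/sem_test_cat[e1 [e2 [-> h1 /sem_test_cons]]]|].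
    move=> [e3 [e4 [-> [_ h3] h4]]]; exists (V ++ U ++ W); rewrite ?mem_head //.
    apply/sem_test_cat; exists e1, (envD e3 e4); split=> //.
    by apply/sem_test_cat; exists e3, e4.
  move=> [_ /[!inE] /eqP-> /sem_test_cat[e1 [e2 [-> h1]]]].
  move=> /sem_test_cat[e3 [e4 [-> h3 h4]]].
  apply/sem_test_cat; exists e1, (envD e3 e4); split=> //.
  by apply/sem_test_cons; exists e3, e4.
- move=> V L Ls W _ IH e; split=> [[bs b /(sem_seq_elt _ _ _ _ IH)[V' V'V h]]|].
    by exists V' => //; exists bs.
  by move=> [V' V'V [bs b h]]; exists bs => //; apply/(sem_seq_elt _ _ _ _ IH);
    exists V'.
Qed.

Lemma sem_reds_test S S' e : reds_test S S' ->
  (exists2 V, V \in S & sem_test V e) <-> (exists2 V, V \in S' & sem_test V e).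
Proof.
have eqsumE (T T' : seq test) : eqsum eqvs T T' ->
    (exists2 V, V \in T & sem_test V e) <-> (exists2 V, V \in T' & sem_test V e).
  move=> [TT' T'T]; split=> -[V].
    by move=> /TT'[V' V'T' /(sem_test_eqvs e) h] /h; exists V'.
  by move=> /T'T[V' V'T /(sem_test_eqvs e) h] /h; exists V'.
elim=> [{}S {}S' /eqsumE //|{}S S1 {}S' [A [As [Bs [rA /eqsumE-> /eqsumE h1]]]] _ <-].
rewrite h1; have {}rA := proj2 (proj2 sem_red) _ _ rA e.
split=> -[V].
  rewrite inE => /predU1P[-> /rA[V' V'A hV]|VB hV].
    by exists V' => //; rewrite mem_cat V'A.
  by exists V => //; rewrite mem_cat VB orbT.
rewrite mem_cat => /orP[VA hV|VB hV]; last by exists V; rewrite // inE VB orbT.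
by exists A; rewrite ?mem_head //; apply/rA; exists V.
Qed.

(** * Adequacy *)

Section SumReduction.
Variables (T : eqType) (e : T -> T -> Prop) (red : T -> seq T -> Prop).
Hypotheses (e_refl : forall A, e A A)
  (e_trans : forall A B C, e A B -> e B C -> e A C).

Lemma eqsum_mem S S' : S =i S' -> eqsum e S S'.
Proof. by move=> h; split=> A AS; exists A; rewrite ?h // -h. Qed.

Lemma eqsum_trans S1 S2 S3 : eqsum e S1 S2 -> eqsum e S2 S3 -> eqsum e S1 S3.
Proof.
move=> [h12 h21] [h23 h32]; split=> A.
  by move=> /h12[B /h23[C C3 BC] AB]; exists C => //; apply: e_trans BC.
by move=> /h32[B /h21[C C3 BC] AB]; exists C => //; apply: e_trans AB.
Qed.

Lemma eqsum_cat S1 S1' S2 S2' :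
  eqsum e S1 S1' -> eqsum e S2 S2' -> eqsum e (S1 ++ S2) (S1' ++ S2').
Proof.
move=> [h1 h1'] [h2 h2']; split=> A; rewrite mem_cat => /orP[].
- by move=> /h1[B B1 AB]; exists B; rewrite ?mem_cat ?B1.
- by move=> /h2[B B1 AB]; exists B; rewrite ?mem_cat ?B1 ?orbT.
- by move=> /h1'[B B1 AB]; exists B; rewrite ?mem_cat ?B1.
- by move=> /h2'[B B1 AB]; exists B; rewrite ?mem_cat ?B1 ?orbT.
Qed.

Notation reds := (reds e red).

(** [reds_refl] contains an equality of sums; the base case absorbs it into the beginning of the
    second reduction. *)
Lemma reds_trans S1 S2 S3 : reds S1 S2 -> reds S2 S3 -> reds S1 S3.
Proof.
elim=> [S S' SS'|S S' S'' SS' _ IH /IH]; last exact: reds_step.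
move=> R; case: R SS' => [X Y XY|X Y Z [A [As [Bs [rA XA YA]]]] YZ] SS'.
  by apply: reds_refl; apply: eqsum_trans XY.
by apply: reds_step YZ; exists A, As, Bs; split=> //; exact: eqsum_trans XA.
Qed.

Lemma reds_catl S S' U : reds S S' -> reds (S ++ U) (S' ++ U).
Proof.
elim=> [{}S {}S' h|{}S S1 {}S' [A [As [Bs [rA h1 h2]]]] _].
  by apply/reds_refl/eqsum_cat => //; apply: eqsum_mem.
apply: reds_step; exists A, As, (Bs ++ U); split=> //.
  by rewrite -cat_cons; apply: eqsum_cat => //; apply: eqsum_mem.
by rewrite catA; apply: eqsum_cat => //; apply: eqsum_mem.
Qed.

Lemma reds_cat S S' U U' : reds S S' -> reds U U' -> reds (S ++ U) (S' ++ U').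
Proof.
move=> /(@reds_catl _ _ U) h /(@reds_catl _ _ S') h'.
apply: reds_trans h _; have catC (X Y : seq T) : reds (X ++ Y) (Y ++ X).
  by apply/reds_refl/eqsum_mem => A; rewrite !mem_cat orbC.
apply: reds_trans (catC _ _) _; exact: reds_trans h' (catC _ _).
Qed.

Lemma reds_red A As : red A As -> reds [:: A] As.
Proof.
move=> rA; apply: reds_step (reds_refl _ (eqsum_mem (fun=> erefl))).
by exists A, As, [::]; rewrite cats0; split=> //; apply: eqsum_mem.
Qed.

(** Addition is idempotent, so a sum of copies of [v] and of 0 collapses to [v] or to 0. *)
Lemma reds_value_or_0 v S :
  (forall A, A \in S -> reds [:: A] [:: v] \/ reds [:: A] [::]) ->
  reds S [:: v] \/ reds S [::].
Proof.
elim: S => [|A S IH] h; first by right; apply/reds_refl/eqsum_mem.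
have hA := h A (mem_head _ _).
have {IH}hS := IH (fun B BS => h B (mem_behead (s := A :: S) BS)).
case: hA hS => hA [] hS; have := reds_cat hA hS => hAS; [left|left|left|right] => //.
apply: reds_trans hAS _; apply/reds_refl/eqsum_mem => B.
by rewrite !inE orbb.
Qed.

End SumReduction.

Lemma eqv_refl M : eqv M M.
Proof.
have eqvsP P : (forall L, L \in P -> eqv L L) -> eqvs P P.
  elim: P => [|L P IH] h; first exact: eqvs_nil.
  apply: eqvs_cons; first by apply: h; rewrite mem_head.
  by apply: IH => L' L'P; apply: h; rewrite inE L'P orbT.
elim/term_ind_in: M => [x|M IH|M P IHM IHP|V IH].
- exact: eqv_var.
- exact: eqv_lam.
- by apply: eqv_app => //; apply: eqvsP.
- by apply/eqv_tbar/eqvsP.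
Qed.

Lemma eqvs_refl P : eqvs P P.
Proof.
elim: P => [|L P IH]; first exact: eqvs_nil.
exact: eqvs_cons (eqv_refl L) IH.
Qed.

(** * Size and free variables along reduction *)

Fixpoint tsize (M : term) : nat :=
  match M with
  | Var _ => 1
  | Lam M => (tsize M).+1
  | App M P => (tsize M + sumn (map tsize P)).+1
  | TBar V => (sumn (map tsize V)).+1
  end.

Notation lsize P := (sumn (map tsize P)).

Lemma tsize_ren r M : tsize (ren r M) = tsize M.
Proof.
have lsizeP P : (forall L, L \in P -> forall r, tsize (ren r L) = tsize L) ->
    forall r, lsize (map (ren r) P) = lsize P.
  move=> h r'; rewrite -map_comp; congr sumn.
  by apply/eq_in_map => L LP; exact: h.
elim/term_ind_in: M r => [x|M IH|M P IHM IHP|V IH] r //=.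
- by rewrite IH.
- by rewrite IHM lsizeP.
- by rewrite lsizeP.
Qed.

(** Every summand contains the argument once, so sizes at most add up. The occurrence consumed is
    not deducted: in a beta step the strict decrease comes from the application and the abstraction
    that disappear. *)
Lemma lsubst_size_free x N M M' : M' \in lsubst x N M ->
  tsize M' <= tsize M + tsize N /\ forall y, free y M' -> free y M || free y N.
Proof.
have sumP P P' : (forall L, L \in P -> forall x N M', M' \in lsubst x N L ->
      tsize M' <= tsize L + tsize N /\
      forall y, free y M' -> free y L || free y N) ->
    forall x N, P' \in sum_at_one (lsubst x N) P ->
      lsize P' <= lsize P + tsize N /\
      forall y, has (free y) P' -> has (free y) P || free y N.
  elim: P P' => [|L P IH] P' h x' N' //=; rewrite mem_cat => /orP[] /mapP[Q].
    move=> /(h L (mem_head _ _))[sz fr] -> /=; split; first by lia.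
    by move=> y /orP[/fr/orP[->|->]|->]; rewrite ?orbT.
  have {}h K KP := h K (mem_behead (s := L :: P) KP).
  move=> /(IH _ h)[sz fr] -> /=; split; first by lia.
  by move=> y /orP[->|/fr/orP[->|->]]; rewrite ?orbT.
elim/term_ind_in: M x N M' => [z|M IH|M P IHM IHP|V IH] x N M' /=.
- case: eqP => // _; rewrite inE => /eqP->; split; first by lia.
  by move=> y ->; rewrite orbT.
- move=> /mapP[M1 /IH[sz fr] -> /=]; rewrite tsize_ren in sz.
  split; first by lia.
  move=> y /fr/orP[->//|/free_ren[z Nz [yz]]]; by rewrite yz Nz orbT.
- rewrite mem_cat => /orP[] /mapP[M1].
    move=> /IHM[sz fr] -> /=; split; first by lia.
    by move=> y /orP[/fr/orP[->|->]|->]; rewrite ?orbT.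
  move=> /(sumP _ _ IHP)[sz fr] -> /=; split; first by lia.
  by move=> y /orP[->|/fr/orP[->|->]]; rewrite ?orbT.
- by move=> /mapP[M1 /(sumP _ _ IH)[sz fr] ->].
Qed.

Lemma lsubst_bag_size_free x P M M' : M' \in lsubst_bag x P M ->
  tsize M' <= tsize M + lsize P /\
  forall y, free y M' -> free y M || has (free y) P.
Proof.
rewrite /lsubst_bag.
suff foldP (S : seq term) :
    M' \in foldl (fun S L => flatten [seq lsubst x L A | A <- S]) S P ->
    exists2 A, A \in S & tsize M' <= tsize A + lsize P /\
      forall y, free y M' -> free y A || has (free y) P.
  by move=> /foldP[A]; rewrite inE => /eqP->.
elim: P S => [|L P IH] S /=; first by move=> M'S; exists M' => //; split;
  [lia | move=> y ->].
move=> /IH[A1 /flattenP[_ /mapP[A AS ->] /lsubst_size_free[sz1 fr1]] [sz fr]].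
exists A => //; split; first by lia.
by move=> y /fr/orP[/fr1/orP[->|->]|->]; rewrite ?orbT.
Qed.

Lemma zsubst_size_free M M' : M' \in zsubst M ->
  tsize M' = tsize M /\ forall y, free y M' -> free y.+1 M.
Proof.
rewrite /zsubst; case: ifPn => // M0; rewrite inE => /eqP->.
rewrite tsize_ren; split=> // y /free_ren[[|x] Mx ->] //.
by move: M0; rewrite Mx.
Qed.

Lemma beta_size_free M P M' : M' \in beta M P ->
  tsize M' < tsize (App (Lam M) P) /\
  forall y, free y M' -> free y (App (Lam M) P).
Proof.
move=> /flattenP[_ /mapP[M1 /lsubst_bag_size_free[sz1 fr1] ->]].
move=> /zsubst_size_free[sz fr].
have szP : lsize (map shift P) = lsize P.
  by rewrite -map_comp; congr sumn; apply: eq_map => L; exact: tsize_ren.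
split=> [|y /fr/fr1/orP[/= ->//|/hasP[_ /mapP[L LP ->]]]] /=.
  by rewrite szP in sz1; lia.
move=> /free_ren[z Lz [yz]]; apply/orP; right.
by apply/hasP; exists L; rewrite ?yz.
Qed.

(** Following the heads of applications in a closed term never ends at a free variable, hence ends
    at an abstraction or a [TBar]; either of them forms a redex once applied. *)
Lemma closed_head_red M : (forall x, ~~ free x M) ->
  [\/ exists M', M = Lam M', exists V, M = TBar V | exists2 Ms, red_tm M Ms &
    forall M', M' \in Ms -> tsize M' < tsize M /\ forall x, ~~ free x M'].
Proof.
elim/term_ind_in: M => [x|M _|M P IH _|V _] cl.
- by have := cl x; rewrite /= eqxx.
- by apply: Or31; exists M.
- have clM x : ~~ free x M by have := cl x; rewrite /= negb_or => /andP[].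
  have clP x : ~~ has (free x) P by have := cl x; rewrite /= negb_or => /andP[].
  apply: Or33; have [[M' ME]|[V ME]|[Ms rM h]] := IH clM; rewrite ?ME in cl *.
  + exists (beta M' P); first exact: red_beta.
    move=> N /beta_size_free[sz fr]; split=> // x.
    by apply/negP => /fr; exact/negP/cl.
  + case: P cl clP {IH} => [|L P] cl clP; last first.
      by exists [::]; first exact: red_tbar_cons.
    exists [:: TBar V]; first exact: red_tbar_nil.
    move=> N; rewrite inE => /eqP->; split=> [|x]; first by rewrite /=; lia.
    by rewrite -ME.
  + exists [seq App M' P | M' <- Ms]; first exact: red_appl.
    move=> _ /mapP[M' /h[sz fr] ->]; split=> [|x] /=; first by lia.
    by rewrite negb_or fr clP.
- by apply: Or32; exists V.
Qed.

(** It is enough to look at the first element: an abstraction or a [TBar] triggers a rule of tests,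
    and any other closed term reduces at its head. *)
Lemma closed_test_red L W : closed_test (L :: W) ->
  exists2 Vs, red_test (L :: W) Vs &
    forall V, V \in Vs -> lsize V < lsize (L :: W) /\ closed_test V.
Proof.
move=> cl; have clL x : ~~ free x L by have := cl x; rewrite /= negb_or => /andP[].
have clW x : ~~ has (free x) W by have := cl x; rewrite /= negb_or => /andP[].
have [[M LE]|[U LE]|[Ms rL h]] := closed_head_red clL; rewrite ?LE in clL *.
- exists [seq M' :: W | M' <- zsubst M]; first exact: (red_tau_lam [::]).
  move=> _ /mapP[M' /zsubst_size_free[sz fr] ->]; split=> [|x] /=; first by lia.
  by rewrite negb_or clW andbT; apply/negP => /fr; exact/negP/clL.
- exists [:: U ++ W]; first exact: (red_tau_tbar [::]).
  move=> V; rewrite inE => /eqP->; rewrite map_cat sumn_cat /=.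
  by split=> [|x]; [lia | rewrite has_cat negb_or clW andbT; exact: clL].
- exists [seq L' :: W | L' <- Ms]; first exact: (red_test_elt [::]).
  move=> _ /mapP[M' /h[sz cl'] ->]; split=> [|x] /=; first by lia.
  by rewrite negb_or clW cl'.
Qed.

(** Induction on the size: a nonempty test steps to a sum of smaller closed tests, each of which
    reduces to [eps] or to 0. *)
Lemma closed_test_reds V : closed_test V ->
  reds_test [:: V] [:: eps] \/ reds_test [:: V] [::].
Proof.
have [n] := ubnP (lsize V); elim: n V => // n IH [|L W] sz cl.
  by left; apply/reds_refl/eqsum_mem => //; exact: eqvs_refl.
have [Vs rV h] := closed_test_red cl.
have rVs : reds_test [:: L :: W] Vs := reds_red eqvs_refl rV.
have [V /h[szV]|hVs|hVs] := reds_value_or_0 eqvs_refl eqvs_trans (v := eps)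
  (red := red_test) (S := Vs); first by apply: IH; lia.
- by left; exact: (reds_trans eqvs_trans rVs hVs).
- by right; exact: (reds_trans eqvs_trans rVs hVs).
Qed.

(** The semantics at [env0] is invariant under reduction, holds for [eps] and fails for the empty
    sum; a closed test reduces to one of these two. *)
Lemma adequacy V : closed_test V ->
  reds_test [:: V] [:: eps] <-> sem_test V env0.
Proof.
move=> cl; have sem_eps : sem_test eps env0 by exists [::].
split=> [/(sem_reds_test env0)[_ h]|semV].
  by have [|V'] := h; [exists eps; rewrite ?mem_head | rewrite inE => /eqP->].
have [//|/(sem_reds_test env0)[h _]] := closed_test_reds cl.
by have [|] := h; first by exists V; rewrite ?mem_head.
Qed.

(** * Contexts *)

Definition upd (e : env) (i : nat) (b : {mset dom}) : env :=
  fun y => if y == i then b else e y.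

Lemma sem_lam i M e alpha : sem (lam i M) e alpha <->
  exists b beta, [/\ alpha = dcons b beta, e i = mset0 & sem M (upd e i b) beta].
Proof.
(* The inverse of the renaming in [lam i]: index 0 comes from [i] and [z.+1] from [z], while [i.+1]
   has no preimage. The latter is why [e i] must be empty. *)
pose s y := if y is z.+1 then if z == i then None else Some z else Some i.
have rs : inv_on (fun j => if j == i then 0 else j.+1) s (free^~ M).
  move=> x _ [|y] /=.
    by rewrite (inj_eq Some_inj) eq_sym; case: (x == i).
  case: (x =P i) => [->|xi] /=; case: (y =P i) => [->|yi] //.
  - by rewrite (inj_eq Some_inj); apply/eqP.
  - by rewrite eqSS; apply/esym/eqP => ix; case: xi.
have pushE e' : env_push s e' = scons (e' i) (fun y => if y == i then mset0 else e' y).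
  by apply: functional_extensionality => -[|y] //; rewrite /env_push /=; case: eqP.
rewrite /lam /=; split.
  move=> [b [beta [-> /(sem_ren _ _ rs)[e' h]]]].
  rewrite pushE => /scons_inj[-> ->]; exists (e' i), beta; rewrite eqxx; split=> //.
  rewrite (_ : upd _ _ _ = e') //; apply: functional_extensionality => y.
  by rewrite /upd; case: eqP => [->|].
move=> [b [beta [-> ei h]]]; exists b, beta; split=> //; apply/(sem_ren _ _ rs).
exists (upd e i b) => //; rewrite pushE /upd eqxx; congr scons.
by apply: functional_extensionality => y; case: eqP => [->|].
Qed.

Lemma free_lam i M x : free x (lam i M) -> x != i /\ free x M.
Proof.
by move=> /= /free_ren[y My]; case: eqP => // yi [->]; split=> //; apply/eqP.
Qed.

Scheme tctx_mut := Induction for tctx Sort Prop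
  with vctx_mut := Induction for vctx Sort Prop.
Combined Scheme ctx_ind from tctx_mut, vctx_mut.

(** Each clause of the semantics is monotone. As environments range over all variables, a capturing
    binder is just an instance of [sem_lam]. *)
Lemma sem_plug_mono M N :
  (forall e alpha, sem M e alpha -> sem N e alpha) ->
  (forall D e alpha, sem (tplug D M) e alpha -> sem (tplug D N) e alpha) /\
  (forall C e, sem_test (vplug C M) e -> sem_test (vplug C N) e).
Proof.
move=> MN; apply: ctx_ind => //=.
- move=> i D IH e alpha /sem_lam[b [beta [-> ei /IH h]]].
  by apply/sem_lam; exists b, beta.
- move=> D IH P e alpha [e1 [e2 [bs [-> /IH h1 h2]]]].
  by exists e1, e2, bs.
- move=> L D IH Ls e alpha [e1 [e2 [[|beta bs] [-> h1 //]]]].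
  move=> [e3 [e4 [-> /IH h3 h4]]]; exists e1, (envD e3 e4), (beta :: bs).
  by split=> //; exists e3, e4.
- by move=> C IH e alpha [-> /IH h].
- move=> D IH Ls e /sem_test_cons[e1 [e2 [-> /IH h1 h2]]].
  by apply/sem_test_cons; exists e1, e2.
Qed.

(** * Definability *)

(* [T] stands for the term alpha^- carrying the test [U] under its
   abstractions, where the tests on the abstracted variables accumulate; the
   arguments [Ps] stand for the test context alpha^+ = tau[(.) Ps]. *)
Definition definable (alpha : dom) : Prop :=
  (forall U eU, (forall e, sem_test U e <-> e = eU) ->
     exists T, forall e beta, sem T e beta <-> e = eU /\ beta = alpha) /\
  (exists Ps, (forall P x, P \in Ps -> ~~ has (free x) P) /\
     forall M e, sem (foldl App M Ps) e star <-> sem M e alpha).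

Lemma sem_test_nil e : sem_test [::] e <-> e = env0.
Proof. by split=> [[[|? ?] _]|->] //; exists [::]. Qed.

(** Each [beta] is defined by a closed term carrying the empty test; these terms together form a bag
    with a single point. *)
Lemma definable_bag bs : (forall beta, beta \in bs -> definable beta) ->
  exists P, forall e b, sem_bag P e b <-> e = env0 /\ b = seq_mset bs.
Proof.
elim: bs => [|beta bs IH] h.
  exists [::] => e b; split=> [[[|? ?] <-]|[-> ->]] //; by exists [::].
have [P hP] := IH (fun g gbs => h g (mem_behead (s := beta :: bs) gbs)).
have [/(_ [::] env0 sem_test_nil)[T hT] _] := h beta (mem_head _ _).
exists (T :: P) => e b; split=> [[[|gamma bs'] <-] //=|[-> ->]].
  move=> [e1 [e2 [-> /hT[-> ->] /sem_bagI/hP[-> bsE]]]].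
  by rewrite envD0 !mset_cons bsE.
have /hP[bs' bsE h'] : env0 = env0 /\ seq_mset bs = seq_mset bs by [].
exists (beta :: bs'); first by rewrite !mset_cons bsE.
by exists env0, env0; rewrite envD0; split=> //; apply/hT.
Qed.

(** For each [beta] in [bs], the variable 0 applied to the arguments that detect [beta] is tested;
    this holds exactly in [env1 0 beta], and the environments add up. *)
Lemma definable_var_test bs : (forall beta, beta \in bs -> definable beta) ->
  exists V, forall e, sem_test V e <-> e = envn 0 (seq_mset bs).
Proof.
elim: bs => [|beta bs IH] h.
  by exists [::] => e; rewrite sem_test_nil seq_mset_nil envn0.
have [V hV] := IH (fun g gbs => h g (mem_behead (s := beta :: bs) gbs)).
have [_ [Ps [_ hPs]]] := h beta (mem_head _ _).
exists (foldl App (Var 0) Ps :: V) => e; rewrite sem_test_cons mset_cons -envnD.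
split=> [[e1 [e2 [-> /hPs -> /hV ->]]] //|->].
exists (env1 0 beta), (envn 0 (seq_mset bs)); split=> //.
- exact/hPs.
- exact/hV.
Qed.

(** The outer induction covers the elements of the entries of [alpha]. The inner one, on a bound for
    the nonempty entries, covers the tail [alpha'] in [alpha = dcons (entry alpha 0) alpha']. *)
Lemma definableP alpha : definable alpha.
Proof.
elim/dom_nested_ind: alpha => alpha IH.
have [n alpha_n] := entry_finite alpha.
elim: n alpha IH alpha_n => [|n IHn] alpha IH alpha_n.
  have -> : alpha = star.
    by apply: dom_ext => i; rewrite entry_star; apply: alpha_n.
  (* The only point of [TBar U] is [star], and testing for [star] takes no arguments. *)
  split=> [U eU hU|]; last by exists [::].
  exists (TBar U) => e beta /=; split=> [[-> /hU]|[/hU]] //.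
have [alpha' alpha'E] : exists alpha', entry alpha' =1 fun i => entry alpha i.+1.
  by apply: (dom_seq (n := n)) => i; exact: (alpha_n i.+1).
have alphaE : alpha = dcons (entry alpha 0) alpha'.
  by apply: dom_ext => -[|i]; rewrite entry_dcons ?alpha'E.
have [|i|defT [Ps [clPs hPs]]] := IHn alpha'.
- by move=> i beta; rewrite alpha'E; exact: IH.
- by rewrite alpha'E; exact: (alpha_n i.+1).
have IH0 beta : beta \in (entry alpha 0 : seq dom) -> definable beta.
  by rewrite -has_pred1 has_count count_mem_mset -in_mset; exact: IH.
split=> [U eU hU|].
  have [V hV] := definable_var_test IH0; rewrite seq_mset_id in hV.
  (* The term for [alpha'] carries both the shifted [U] and the test [V], which forces the variable
     about to be abstracted to receive the first entry. *)
  have [|T hT] := defT (V ++ map shift U) (scons (entry alpha 0) eU).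
    move=> e; rewrite sem_test_cat scons_envn.
    split=> [[e1 [e2 [-> /hV-> [bs b /sem_seq_shift[e2' h ->]]]]]|->].
      by rewrite envDC; have -> : e2' = eU by apply/hU; exists bs.
    exists (envn 0 (entry alpha 0)), (scons mset0 eU).
    rewrite envDC; split=> //; first exact/hV.
    have /hU[bs b h] := erefl eU.
    by exists bs => //; apply/sem_seq_shift; exists eU.
  exists (Lam T) => e beta; split=> [[b [gamma [-> /hT[]]]]|[-> ->]].
    by move=> /scons_inj[-> ->] ->; rewrite -alphaE.
  by exists (entry alpha 0), alpha'; split=> //; apply/hT.
(* The first argument supplies exactly the first entry; the remaining ones test the result for
   [alpha']. *)
have [P hP] := definable_bag IH0; rewrite seq_mset_id in hP.
have P_env0 : sem_bag P env0 (entry alpha 0) by apply/hP.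
exists (P :: Ps); split=> [Q x|M e].
  rewrite inE => /predU1P[->|/clPs //].
  by have [bs _ /sem_seq_free->] := P_env0; rewrite eqxx.
rewrite /= hPs alphaE; split=> [[e1 [e2 [bs [-> h /sem_bagI/hP[-> <-]]]]]|h].
  by rewrite envD0.
have [bs bsE hbs] := P_env0.
by exists e, env0, bs; rewrite envD0 bsE.
Qed.

(** A variable outside the list has index [n], which is out of range, and so receives the default
    [mset0]. *)
Definition env_of n (xs : n.-tuple nat) (a : mtup n) : env :=
  fun x => nth mset0 a (index x xs).

(** * Semantics over a list of variables *)

Lemma index_tuple (T : eqType) n (xs : n.-tuple T) x :
  (index x xs < n) = (x \in xs).
Proof. by rewrite -index_mem size_tuple. Qed.

Lemma env_of_notin n (xs : n.-tuple nat) a x : x \notin xs -> env_of xs a x = mset0.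
Proof.
by move=> xxs; rewrite /env_of nth_default // size_tuple leqNgt index_tuple.
Qed.

Lemma env_ofD n (xs : n.-tuple nat) a1 a2 :
  env_of xs (mtupD a1 a2) = envD (env_of xs a1) (env_of xs a2).
Proof.
apply: functional_extensionality => x; rewrite /env_of /envD.
case: (ltnP (index x xs) n) => h; last first.
  by rewrite !nth_default ?size_tuple // msetD0.
by rewrite -[index x xs]/(val (Ordinal h)) -!tnth_nth tnth_mktuple.
Qed.

Lemma env_of0 n (xs : n.-tuple nat) : env_of xs (mtup0 n) = env0.
Proof.
apply: functional_extensionality => x; rewrite /env_of.
case: (ltnP (index x xs) n) => h; last by rewrite nth_default ?size_tuple.
by rewrite -[index x xs]/(val (Ordinal h)) -tnth_nth tnth_mktuple.
Qed.

Lemma env_of1 n (xs : n.-tuple nat) i alpha : uniq xs ->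
  env_of xs (mtup1 i alpha) = env1 (tnth xs i) alpha.
Proof.
move=> xsU; apply: functional_extensionality => x; rewrite /env_of /env1.
case: (ltnP (index x xs) n) => h; last first.
  rewrite nth_default ?size_tuple //; case: eqP => // xE.
  by move: h; rewrite leqNgt index_tuple xE mem_tnth.
rewrite -[index x xs]/(val (Ordinal h)) -tnth_nth tnth_mktuple.
have xE : tnth xs (Ordinal h) = x.
  by rewrite (tnth_nth 0) /= nth_index // -index_mem size_tuple.
by rewrite -{2}xE (inj_eq (tuple_uniqP _ xsU)).
Qed.

(** Entering a binder appends the bound variable at the end of the list but under the name 0, with
    the other names shifted; as a function of names this is [scons]. *)
Lemma env_of_rcons n (xs : n.-tuple nat) (a : mtup n) b :
  env_of [tuple of rcons (map succn xs) 0] [tuple of rcons a b] =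
  scons b (env_of xs a).
Proof.
have indexS x : index x.+1 (map succn xs) = index x xs.
  by apply: index_map; exact: succn_inj.
apply: functional_extensionality => -[|x]; rewrite /env_of /= -!cats1 index_cat.
  rewrite (_ : 0 \in _ = false) /= ?addn0; last by apply/mapP => -[].
  by rewrite nth_cat size_map !size_tuple ltnn subnn.
rewrite (mem_map succn_inj) indexS nth_cat size_tuple.
case: (boolP (x \in xs)) => [xxs|/negPf xxs /=]; first by rewrite index_tuple xxs.
rewrite size_map size_tuple addn1 ltnNge leqnSn /= subSnn /=.
by rewrite nth_default // size_tuple leqNgt index_tuple xxs.
Qed.

Lemma env_of_surj n (xs : n.-tuple nat) e : uniq xs ->
  (forall x, e x != mset0 -> x \in xs) -> exists a, e = env_of xs a.
Proof.
move=> xsU h; exists [tuple e (tnth xs i) | i < n].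
apply: functional_extensionality => x; rewrite /env_of.
case: (boolP (x \in xs)) => [xxs|xxs]; last first.
  rewrite nth_default; last by rewrite size_tuple leqNgt index_tuple.
  by apply/eqP/negPn; apply: contra xxs; exact: h.
have hx : index x xs < n by rewrite index_tuple.
rewrite -[index x xs]/(val (Ordinal hx)) -tnth_nth tnth_mktuple.
by rewrite (tnth_nth 0) nth_index.
Qed.

Lemma env_of_inj n (xs : n.-tuple nat) : uniq xs -> injective (env_of xs).
Proof.
move=> xsU a1 a2 h; apply: eq_from_tnth => i.
have := congr1 (@^~ (tnth xs i)) h; rewrite /env_of.
by rewrite (tnth_nth 0) index_uniq ?size_tuple // -!tnth_nth.
Qed.

(** A sum of multisets is empty only if both summands are, so [e1] and [e2] vanish outside the list
    as their sum does. *)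
Lemma env_of_splitD n (xs : n.-tuple nat) a e1 e2 : uniq xs ->
  env_of xs a = envD e1 e2 ->
  exists a1 a2, [/\ a = mtupD a1 a2, e1 = env_of xs a1 & e2 = env_of xs a2].
Proof.
move=> xsU aE.
have supp x : envD e1 e2 x != mset0 -> x \in xs.
  rewrite -aE; apply: contraR => xxs.
  by rewrite env_of_notin.
have [x h|a1 e1E] := @env_of_surj _ xs e1 xsU.
  by apply: supp; rewrite msetD_eq0 negb_and h.
have [x h|a2 e2E] := @env_of_surj _ xs e2 xsU.
  by apply: supp; rewrite msetD_eq0 negb_and h orbT.
exists a1, a2; split=> //; apply: (env_of_inj xsU).
by rewrite aE env_ofD e1E e2E.
Qed.

Lemma interp_bag_sem n (xs : n.-tuple nat) P : uniq xs ->
  (forall L, L \in P -> forall a alpha,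
     interp xs L a alpha <-> sem L (env_of xs a) alpha) ->
  forall a b, interp_bag xs P a b <-> sem_bag P (env_of xs a) b.
Proof.
move=> xsU; elim: P => [|L P IH] h a b.
  split=> [[-> ->]|[[|//] <- /=]].
    by exists [::]; rewrite ?seq_mset_nil ?env_of0.
  by rewrite -(env_of0 xs) seq_mset_nil => /(env_of_inj xsU).
have {}IH := IH (fun L' L'P => h L' (mem_behead (s := L :: P) L'P)).
have {}h := h L (mem_head _ _); split.
  move=> [a1 [a2 [beta [b' [-> -> /h h1 /IH[bs <- h2]]]]]].
  exists (beta :: bs); rewrite ?mset_cons // env_ofD.
  by exists (env_of xs a1), (env_of xs a2).
move=> [[|beta bs] <- //] [e1 [e2 [/(env_of_splitD xsU)[a1 [a2 [-> -> ->]]]]]].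
move=> /h h1 /sem_bagI/IH h2.
by exists a1, a2, beta, (seq_mset bs); rewrite mset_cons.
Qed.

Lemma interp_test_sem n (xs : n.-tuple nat) V : uniq xs ->
  (forall L, L \in V -> forall a alpha,
     interp xs L a alpha <-> sem L (env_of xs a) alpha) ->
  forall a, interp_test xs V a <-> sem_test V (env_of xs a).
Proof.
move=> xsU; elim: V => [|L P IH] h a.
  rewrite sem_test_nil -(env_of0 xs).
  by split=> [->|/(env_of_inj xsU)].
have {}IH := IH (fun L' L'P => h L' (mem_behead (s := L :: P) L'P)).
have {}h := h L (mem_head _ _); rewrite sem_test_cons; split.
  move=> [a1 [a2 [-> /h h1 /IH h2]]]; rewrite env_ofD.
  by exists (env_of xs a1), (env_of xs a2).
move=> [e1 [e2 [/(env_of_splitD xsU)[a1 [a2 [-> -> ->]]] /h h1 /IH h2]]].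
by exists a1, a2.
Qed.

Lemma interp_sem n (xs : n.-tuple nat) M a alpha : uniq xs ->
  interp xs M a alpha <-> sem M (env_of xs a) alpha.
Proof.
elim/term_ind_in: M n xs a alpha => [x|M IH|M P IHM IHP|V IH] n xs a alpha xsU /=.
- split=> [[i <- ->]|aE]; first exact: env_of1.
  (* The environment is nonempty at [x], which is possible only inside the list. *)
  have /tnthP[i xE] : x \in xs.
    have : env_of xs a x != mset0.
      rewrite aE /env1 eqxx; apply/eqP => /msetP/(_ alpha).
      by rewrite msetnxx mset0E.
    apply: contraR => xxs.
    by rewrite env_of_notin.
  exists i => //; apply: (env_of_inj xsU).
  by rewrite env_of1 // -xE.
- have xsU' : uniq [tuple of rcons (map succn xs) 0].
    rewrite rcons_uniq (map_inj_uniq succn_inj) xsU andbT.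
    by apply/mapP => -[].
  split=> -[b [beta [-> h]]]; exists b, beta; split=> //; move: h;
    by rewrite (IH _ _ _ _ xsU') env_of_rcons.
- have hP := interp_bag_sem xsU (fun L LP a alpha => IHP L LP n xs a alpha xsU).
  split.
    move=> [a1 [a2 [b [-> /(IHM _ _ _ _ xsU) h1 /hP[bs bE h2]]]]].
    by exists (env_of xs a1), (env_of xs a2), bs; rewrite env_ofD bE.
  move=> [e1 [e2 [bs [/(env_of_splitD xsU)[a1 [a2 [-> -> ->]]]]]]].
  move=> /(IHM _ _ _ _ xsU) h1 /sem_bagI/hP h2.
  by exists a1, a2, (seq_mset bs).
- have hV := interp_test_sem xsU (fun L LV a alpha => IH L LV n xs a alpha xsU).
  by split=> -[-> /hV h].
Qed.

(** By [sem_free], every environment of [M] is supported on the free variables of [M], hence is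
    given by a tuple over the list. *)
Lemma interp_le_sem (M N : term) (n : nat) (xs : n.-tuple nat) : uniq xs ->
  (forall x, free x M -> x \in xs) ->
  (forall a alpha, interp xs M a alpha -> interp xs N a alpha) <->
  (forall e alpha, sem M e alpha -> sem N e alpha).
Proof.
move=> xsU M_xs; split=> h => [e|a] alpha.
  move=> hM; have [x ex|a aE] := @env_of_surj _ xs e xsU.
    by apply: M_xs; rewrite (sem_free hM).
  by move: hM; rewrite aE -!interp_sem //; exact: h.
by rewrite !interp_sem //; exact: h.
Qed.

(** * Full abstraction *)

(* Abstracting the variables moves the environment [E] into the point, so that a
   closing context can test for both at once. *)
Lemma sem_lams ys E e M alpha : uniq ys -> (forall y, y \in ys -> e y = mset0) ->
  sem (foldr lam M ys) e (foldr dcons alpha (map E ys)) <->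
  sem M (fun y => if y \in ys then E y else e y) alpha.
Proof.
elim: ys e => [//|y ys IH] e; rewrite cons_uniq => /andP[yys ysU] e0.
rewrite -[foldr lam M _]/(lam y (foldr lam M ys)).
have updE : (fun z => if z \in y :: ys then E z else e z) =
    fun z => if z \in ys then E z else upd e y (E y) z.
  apply: functional_extensionality => z; rewrite inE /upd.
  by case: eqP => [->|] //=; case: ifP.
rewrite updE -IH //; last first.
  move=> z zys; rewrite /upd; case: eqP => [zy|_]; first by rewrite -zy zys in yys.
  by apply: e0; rewrite inE zys orbT.
rewrite sem_lam [foldr dcons _ _]/=.
split=> [[b [beta [/dcons_inj[<- <-] _ h]]]|h] //.
by exists (E y), (foldr dcons alpha (map E ys)); split=> //; apply/e0/mem_head.
Qed.

Lemma free_lams ys M x : free x (foldr lam M ys) -> x \notin ys /\ free x M.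
Proof.
elim: ys => //= y ys IH /free_lam[xy /IH[xys Mx]]; split=> //.
by rewrite inE negb_or xy.
Qed.

Lemma free_apps M Ps x : free x (foldl App M Ps) ->
  free x M \/ exists2 P, P \in Ps & has (free x) P.
Proof.
elim: Ps M => [|P Ps IH] M /=; first by left.
case/IH => [/= /orP[Mx|Px]|[Q QPs Qx]]; first by left.
  by right; exists P; rewrite ?mem_head.
by right; exists Q; rewrite // inE QPs orbT.
Qed.

Lemma tplug_apps D Ps M :
  tplug (foldl CAppL D Ps) M = foldl App (tplug D M) Ps.
Proof. by elim: Ps D => //= P Ps IH D; rewrite IH. Qed.

Lemma tplug_lams D ys M : tplug (foldr CLam D ys) M = foldr lam (tplug D M) ys.
Proof. by elim: ys => //= y ys ->. Qed.

Theorem theorem5p11 (M N : term) (n : nat) (xs : n.-tuple nat)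
    (xs_uniq : uniq xs)
    (M_xs : forall x, free x M -> x \in xs)
    (N_xs : forall x, free x N -> x \in xs) :
  (forall (a : mtup n) (alpha : dom), interp xs M a alpha -> interp xs N a alpha)
  <-> obs_le M N.
Proof.
rewrite (interp_le_sem _ xs_uniq M_xs); split=> [MN C clM clN|MN e alpha hM].
  (* Adequacy turns both convergences into inhabitation at [env0], which monotonicity transports
     from [M] to [N]. *)
  by move=> /(adequacy clM)/(proj2 (sem_plug_mono MN)) /(adequacy clN).
(* This point of the abstracted [M] encodes the whole pair of [e] and [alpha]; [Ps] are closed bags
   that detect it. *)
have [_ [Ps [clPs hPs]]] := definableP (foldr dcons alpha (map e xs)).
pose C := CTau (foldl CAppL (foldr CLam Hole xs) Ps) [::].
have CE L : vplug C L = [:: foldl App (foldr lam L xs) Ps].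
  by rewrite /= tplug_apps tplug_lams.
have closedC L : (forall x, free x L -> x \in xs) -> closed_test (vplug C L).
  move=> L_xs x; rewrite CE /= orbF; apply/negP.
  case/free_apps => [/free_lams[xxs /L_xs]|[P PPs]]; first by rewrite (negPf xxs).
  exact/negP/clPs.
have semC L : sem_test (vplug C L) env0 <-> sem L e alpha.
  rewrite CE sem_test1 hPs sem_lams //.
  (* Outside [xs] the environment obtained is empty, and so is [e], because [M] has no free variable
     there. *)
  rewrite (_ : (fun y => _) = e) //; apply: functional_extensionality => y.
  case: ifPn => // yxs; apply/esym/eqP/negPn; rewrite -(sem_free hM).
  by apply: contra yxs; exact: M_xs.
apply/semC/(adequacy (closedC N N_xs))/MN; try exact: closedC.
exact/(adequacy (closedC M M_xs))/semC.
Qed.
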